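(* Let $G$ be a locally finite acyclic directed graph with edge weights in a commutative ring, embedded in the plane, and let $\mathbf{u}=(u_1,\ldots,u_m)$ and $\mathbf{v}=(v_1,\ldots,v_n)$ be tuples of vertices of $G$ with $m\le n$. Assume $v_1,\ldots,v_n$ are sinks of $G$ and lie on the unbounded face of $G$ in this cyclic order, so that the graphs $\overline{G_{sym}}$ and $\widetilde{G_{sym}}$ described below are defined. Then \[ \Bigg[\sum_{\sigma\in S_m}\operatorname{sgn}(\sigma)\operatorname{GF}[\mathscr{P}_0(\mathbf{u}_{\sigma},\mathbf{v})]\Bigg]^2=\sum_{\sigma\in S_m}\operatorname{sgn}(\sigma)\operatorname{GF}[\overline{\mathscr{P}_0}(\mathbf{u}_{\sigma},\mathbf{u}')]=\sum_{\sigma\in S_m}\operatorname{sgn}(\sigma)\operatorname{GF}[\widetilde{\mathscr{P}_0}(\mathbf{u}_{\sigma},\mathbf{u}')]. \] In particular, if $\mathbf{u}$ and $\mathbf{v}$ are compatible, then $\operatorname{GF}[\mathscr{P}_{0}(\mathbf{u},\mathbf{v})]^2=\operatorname{GF}[\overline{\mathscr{P}_{0}}(\mathbf{u},\mathbf{u'})]=\operatorname{GF}[\widetilde{\mathscr{P}_{0}}(\mathbf{u},\mathbf{u'})]$.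
   Context: All paths are directed; the weight of a path is the product of its edge weights (length-zero paths have weight $1$), the weight of a tuple of paths is the product of the weights of its paths, and a tuple is nonintersecting if no two paths share a vertex. $\operatorname{GF}$ of a set of paths or tuples is the sum of their weights (assumed well defined). For $\sigma\in S_m$, $\mathscr{P}_0(\mathbf{u}_\sigma,\mathbf{v})$ is the set of nonintersecting $m$-tuples $(P_1,\ldots,P_m)$ in $G$ with $P_k$ a path from $u_{\sigma(k)}$ to $v_{j_k}$ for some $j_1<\cdots<j_m$. Construction: choose a line $l$ disjoint from $G$ and let $G'$ be the mirror image of $G$ in $l$; for each vertex $x$ of $G$, $x'$ is its mirror image, and each edge $e$ of $G$ from $x$ to $y$ gives an edge $e'$ of $G'$ from $y'$ to $x'$ (reversed direction) with $\operatorname{wt}(e')=\operatorname{wt}(e)$. Let $\mathbf{u}'=(u_1',\ldots,u_m')$, $\mathbf{v}'=(v_1',\ldots,v_n')$, and $G_{sym}=G\cup G'$. The graph $\overline{G_{sym}}$ is obtained from $G_{sym}$ by adding weight-$1$ edges $v_i\to v_i'$ ($i\in[n]$), $v_i\to v_{i+1}'$ ($i\in[n-1]$), and $v_i'\to v_{i+1}'$ ($i\in[n-1]$); the graph $\widetilde{G_{sym}}$ is obtained from $G_{sym}$ by adding weight-$1$ edges $v_i\to v_i'$ ($i\in[n]$), $v_{i+1}\to v_i'$ ($i\in[n-1]$), and $v_{i+1}'\to v_i'$ ($i\in[n-1]$); in both cases the new edges are drawn without crossing other edges. For $\sigma\in S_m$, $\overline{\mathscr{P}_0}(\mathbf{u}_\sigma,\mathbf{u}')$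 (resp. $\widetilde{\mathscr{P}_0}(\mathbf{u}_\sigma,\mathbf{u}')$) is the set of nonintersecting $m$-tuples $(P_1,\ldots,P_m)$ of paths in $\overline{G_{sym}}$ (resp. $\widetilde{G_{sym}}$) with $P_i$ a path from $u_{\sigma(i)}$ to $u_i'$; the subscript is dropped when $\sigma=\mathrm{id}$. Tuples $\mathbf{u}$, $\mathbf{v}$ are compatible if for all $i<j$ in $[m]$ and $k<l$ in $[n]$, every path from $u_i$ to $v_l$ intersects every path from $u_j$ to $v_k$. *)

(* Defs.v *)
From HB Require Import structures.
From mathcomp Require Import all_boot all_order all_algebra all_fingroup.
From mathcomp Require Import all_classical all_reals all_analysis.
Set Implicit Arguments.
Unset Strict Implicit.
Unset Printing Implicit Defensive.
Import Order.TTheory GRing.Theory Num.Theory.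
Import numFieldNormedType.Exports.
Local Open Scope classical_set_scope.
Local Open Scope ring_scope.

(* Parallel edges are allowed: edges form a type of their own. *)
Record wdigraph (K : comPzRingType) := WDigraph {
  vert : choiceType;
  edge : choiceType;
  src : edge -> vert;
  tgt : edge -> vert;
  wt : edge -> K }.

Section Paths.
Context {K : comPzRingType} {G : wdigraph K}.

(* A path is its initial vertex together with its sequence of edges, so that
   the length-zero paths at different vertices are distinct. *)
Definition gpath : choiceType := (vert G * seq (edge G))%type.

Fixpoint walk (x : vert G) (s : seq (edge G)) (y : vert G) : Prop :=
  if s is e :: s' then src e = x /\ walk (tgt e) s' y else x = y.

Definition paths (x y : vert G) : set gpath :=
  [set p | p.1 = x /\ walk x p.2 y].

Definition path_verts (p : gpath) : seq (vert G) :=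
  p.1 :: [seq tgt e | e <- p.2].

Definition path_wt (p : gpath) : K := \prod_(e <- p.2) wt e.

Definition intersect (p q : gpath) : Prop :=
  exists2 x, x \in path_verts p & x \in path_verts q.

Definition tuple_wt m (P : {ffun 'I_m -> gpath}) : K :=
  \prod_(k < m) path_wt (P k).

Definition nonintersecting m (P : {ffun 'I_m -> gpath}) : Prop :=
  forall k l : 'I_m, k != l -> ~ intersect (P k) (P l).

(* The finitely supported sum [\sum_(_ \in _)] has junk value 0 when infinitely
   many terms are nonzero; [GF_defined] below excludes this. *)
Definition GF m (A : set {ffun 'I_m -> gpath}) : K :=
  \sum_(P \in A) tuple_wt P.

Definition GF_defined (A : set gpath) : Prop :=
  finite_set (A `&` [set p | path_wt p != 0]).

(* Nonintersecting tuples with P_k from a_(s k) to some v_(j_k), j increasing *)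
Definition P0 m n (a : 'I_m -> vert G) (v : 'I_n -> vert G) (s : 'S_m) :
    set {ffun 'I_m -> gpath} :=
  [set P | nonintersecting P /\
    exists j : 'I_m -> 'I_n,
      (forall k l : 'I_m, (k < l)%N -> (j k < j l)%N) /\
      forall k, paths (a (s k)) (v (j k)) (P k)].

(* Nonintersecting tuples with P_k from a_(s k) to b_k *)
Definition P0fix m (a b : 'I_m -> vert G) (s : 'S_m) :
    set {ffun 'I_m -> gpath} :=
  [set P | nonintersecting P /\ forall k, paths (a (s k)) (b k) (P k)].

Definition compatible m n (u : 'I_m -> vert G) (v : 'I_n -> vert G) : Prop :=
  forall (i j : 'I_m) (k l : 'I_n), (i < j)%N -> (k < l)%N ->
  forall p q, paths (u i) (v l) p -> paths (u j) (v k) q -> intersect p q.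

Definition sink (x : vert G) : Prop := forall e : edge G, src e <> x.

End Paths.
Arguments gpath {K} G.

Definition locally_finite (K : comPzRingType) (G : wdigraph K) : Prop :=
  forall x : vert G, finite_set [set e : edge G | src e = x \/ tgt e = x].

Definition acyclic (K : comPzRingType) (G : wdigraph K) : Prop :=
  forall (x : vert G) (s : seq (edge G)), walk x s x -> s = [::].

Section Drawing.
Context {R : realType} {K : comPzRingType} {G : wdigraph K}.

Record drawing := Drawing {
  pos : vert G -> R * R;
  curve : edge G -> R -> R * R (* parametrized by [0, 1] *) }.

Definition plane_embedding (D : drawing) : Prop :=
  [/\ injective (pos D),
      forall e, [/\ {within `[0, 1], continuous (curve D e)},
                    {in `[0, 1] &, injective (curve D e)},
                    curve D e 0 = pos D (src e) & curve D e 1 = pos D (tgt e)],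
      forall e (t : R) x, t \in `]0, 1[ -> curve D e t <> pos D x &
      forall e f (t s : R), e != f -> t \in `]0, 1[ -> s \in `]0, 1[ ->
        curve D e t <> curve D f s].

Definition drawn (D : drawing) : set (R * R) :=
  range (pos D) `|` \bigcup_e (curve D e @` `[0, 1]).

Definition unbounded_face (D : drawing) (F : set (R * R)) : Prop :=
  (exists2 z, (~` drawn D) z & F = connected_component (~` drawn D) z) /\
  ~ bounded_set F.

(* [v_0, ..., v_(n-1)] lie on the unbounded face in this cyclic order: some
   topologically embedded closed disc contained in the face, except that it
   touches the graph exactly at the [v i], meets them in this order along its
   boundary. The disc is parametrized by the unit square; as boundary points may
   be moved around by reparametrization, the [v i] are taken on the bottom side.
   The sense of rotation (clockwise or not) is left free. *)
Definition on_unbounded_face_in_cyclic_order (D : drawing) n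
    (v : 'I_n -> vert G) : Prop :=
  let square := [set z : R * R | z.1 \in `[0, 1] /\ z.2 \in `[0, 1]] in
  exists (F : set (R * R)) (phi : R * R -> R * R) (t : 'I_n -> R),
    [/\ unbounded_face D F,
        {within square, continuous phi} /\ {in square &, injective phi},
        (forall i, t i \in `[0, 1]) /\
        (forall i j : 'I_n, (i < j)%N -> t i < t j),
        forall i, phi (t i, 0) = pos D (v i) &
        forall z, square z -> (forall i, z <> (t i, 0)) -> F (phi z)].

End Drawing.
Arguments drawing R {K} G.

Section Construction.
Context {K : comPzRingType}.

Definition mirror (G : wdigraph K) : wdigraph K :=
  @WDigraph K (vert G) (edge G) (@tgt K G) (@src K G) (@wt K G).

Definition gunion (G H : wdigraph K) : wdigraph K :=
  @WDigraph K (vert G + vert H)%type (edge G + edge H)%type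
    (fun e => match e with inl a => inl (src a) | inr a => inr (src a) end)
    (fun e => match e with inl a => inl (tgt a) | inr a => inr (tgt a) end)
    (fun e => match e with inl a => wt a | inr a => wt a end).

Definition add_edges (G : wdigraph K) (N : choiceType) (s t : N -> vert G) :
    wdigraph K :=
  @WDigraph K (vert G) (edge G + N)%type
    (fun e => match e with inl a => src a | inr a => s a end)
    (fun e => match e with inl a => tgt a | inr a => t a end)
    (fun e => match e with inl a => wt a | inr _ => 1 end).

(* The geometric mirror image only serves to draw the graph: G and its image
   being disjoint, their union is the disjoint union. *)
Definition Gsym (G : wdigraph K) : wdigraph K := gunion G (mirror G).

(* pairs of consecutive indices (i, i + 1) *)
Definition consec n := {ij : 'I_n * 'I_n | ij.2 == ij.1.+1 :> nat}.

Definition new_edge n : choiceType := ('I_n + consec n + consec n)%type.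

Section Connect.
Variables (G : wdigraph K) (n : nat) (v : 'I_n -> vert G).
Let o (i : 'I_n) : vert (Gsym G) := inl (v i).
Let o' (i : 'I_n) : vert (Gsym G) := inr (v i).

(* v_i -> v'_i,  v_i -> v'_(i+1),  v'_i -> v'_(i+1) *)
Definition Gbar : wdigraph K :=
  @add_edges (Gsym G) (new_edge n)
    (fun e => match e with
              | inl (inl i) => o i
              | inl (inr c) => o (val c).1
              | inr c => o' (val c).1
              end)
    (fun e => match e with
              | inl (inl i) => o' i
              | inl (inr c) => o' (val c).2
              | inr c => o' (val c).2
              end).

(* v_i -> v'_i,  v_(i+1) -> v'_i,  v'_(i+1) -> v'_i *)
Definition Gtilde : wdigraph K :=
  @add_edges (Gsym G) (new_edge n)
    (fun e => match e with
              | inl (inl i) => o i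
              | inl (inr c) => o (val c).2
              | inr c => o' (val c).2
              end)
    (fun e => match e with
              | inl (inl i) => o' i
              | inl (inr c) => o' (val c).1
              | inr c => o' (val c).1
              end).

Definition P0bar m (u : 'I_m -> vert G) (s : 'S_m) :
    set {ffun 'I_m -> gpath Gbar} :=
  @P0fix K Gbar m (fun k => inl (u k)) (fun k => inr (u k)) s.

Definition P0tilde m (u : 'I_m -> vert G) (s : 'S_m) :
    set {ffun 'I_m -> gpath Gtilde} :=
  @P0fix K Gtilde m (fun k => inl (u k)) (fun k => inr (u k)) s.

End Connect.
End Construction.
Arguments P0bar {K G n} v {m} u s.
Arguments P0tilde {K G n} v {m} u s.

(* Main.v *)
Require Import Defs.
From HB Require Import structures.
From mathcomp Require Import all_boot all_order all_algebra all_fingroup.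
From mathcomp Require Import ring zify.
Set Implicit Arguments.
Unset Strict Implicit.
Unset Printing Implicit Defensive.
Import Order.TTheory GRing.Theory Num.Theory.
Local Open Scope ring_scope.

(* Let A be the matrix of the path generating functions from u_i to v_a. By
   Lindstrom's lemma the left-hand side is the square of the sum of the maximal
   minors of A. A path of Gbar from u_i to u'_j is a path of G from u_i to some
   v_a, a path along added edges to some v'_b, and a reversed path of G from u_j
   to v_b, so Lindstrom's lemma turns the other two sums into det (A L A^T) and
   det (A L^T A^T), where L has ones on the diagonal and twos above it.

   The identity (sum of the maximal minors of A)^2 = det (A L A^T) is polynomial
   in A, so it may be proved over domains in which 2 <> 0, and row operations
   reduce it to A = [A' | c e_m]. The difference of the two sides is then
   2 c (D - S' S''), where S' and S'' are the sums of the maximal minors of A'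
   and of A' without its last row, and D is a bordered determinant. The relation
   L + L^T = 2 (1 ... 1)^T (1 ... 1) gives D^2 = S'^2 S''^2 by induction, and the
   sign is found by specialization. *)

(** * Increasing index maps and sums of maximal minors *)

Definition increasing m n (j : 'I_m -> 'I_n) : bool :=
  [forall k : 'I_m, forall l : 'I_m, (k < l)%N ==> (j k < j l)%N].

Lemma increasingP m n (j : 'I_m -> 'I_n) :
  reflect (forall k l : 'I_m, (k < l)%N -> (j k < j l)%N) (increasing j).
Proof.
by apply: (iffP forallP) => [H k l|H k]; [move/forallP/(_ l)/implyP: (H k)|
  apply/forallP=> l; apply/implyP; exact: H].
Qed.

Lemma increasing_ge m n (j : 'I_m -> 'I_n) : increasing j ->
  forall k : 'I_m, (k <= j k)%N.
Proof.
move=> /increasingP jP [k km]; elim: k km => [|k IHk] km //=.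
by apply: leq_ltn_trans (IHk (ltnW km)) _; exact: jP.
Qed.

(** An increasing map satisfies [k <= j k]; for the conjugate of [j] by [rev_ord] the same bound
    gives the opposite inequality. *)
Lemma increasing_endo m (j : 'I_m -> 'I_m) : increasing j -> j =1 id.
Proof.
move=> jP k; apply/val_inj/eqP => /=; rewrite eqn_leq increasing_ge // andbT.
have rP : increasing (fun i => rev_ord (j (rev_ord i))).
  apply/increasingP=> i l il /=.
  have /(increasingP _ jP) /= : (rev_ord l < rev_ord i)%N.
    by have := ltn_ord l; move: il => /=; lia.
  by have := ltn_ord (j (rev_ord i)); lia.
have := increasing_ge rP (rev_ord k); rewrite rev_ordK /=.
by have := ltn_ord (j k); have := ltn_ord k; lia.
Qed.

Lemma perm_ltn_id m (s : 'S_m) :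
  (forall k l : 'I_m, (s k < s l)%N -> (k < l)%N) -> s = 1%g.
Proof.
move=> mono; have inc : increasing (s^-1)%g.
  by apply/increasingP => k l kl; apply: mono; rewrite !permKV.
apply/permP => k; rewrite perm1; apply: (@perm_inj _ (s^-1)%g).
by rewrite permK (increasing_endo inc).
Qed.

Section MinorSum.
Context {R : comPzRingType}.

Definition minor_sum m n (A : 'M[R]_(m, n)) : R :=
  \sum_(j : {ffun 'I_m -> 'I_n} | increasing j) \det (colsub j A).

(* The entry [(a, b)] counts the paths from [v_a] to [v'_b] in [Gbar] that use
   added edges only. *)
Definition link_mx n : 'M[R]_n :=
  \matrix_(a, b) ((a <= b)%N%:R + (a < b)%N%:R).

Lemma minor_sum_mulmx m n (g : 'M[R]_m) (A : 'M[R]_(m, n)) :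
  minor_sum (g *m A) = \det g * minor_sum A.
Proof.
rewrite /minor_sum big_distrr /=; apply: eq_bigr => j _; rewrite -det_mulmx.
by congr (\det _); apply/matrixP=> a b; rewrite !mxE; apply: eq_bigr => k _;
  rewrite !mxE.
Qed.

Lemma minor_sum0 n (A : 'M[R]_(0, n)) : minor_sum A = 1.
Proof.
have e (f g : {ffun 'I_0 -> 'I_n}) : f = g by apply/ffunP => -[].
have f0 : {ffun 'I_0 -> 'I_n} by apply: finfun => -[].
rewrite /minor_sum (big_pred1 f0) ?det_mx00 // => f.
by rewrite (e f f0) /= eqxx; apply/increasingP => -[].
Qed.

Lemma minor_sum_square n (A : 'M[R]_n) : minor_sum A = \det A.
Proof.
rewrite /minor_sum (big_pred1 [ffun k => k]) => [|f].
  by congr (\det _); apply/matrixP=> i j; rewrite !mxE ffunE.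
apply/idP/eqP => [fP|->]; last by apply/increasingP => k l; rewrite !ffunE.
by apply/ffunP => k; rewrite ffunE; exact: increasing_endo.
Qed.

(** Increasing maps are sorted by whether they use the last column. Those that do send the last row
    to it, and their minors are lower block triangular. *)
Lemma minor_sum_block m n (A : 'M[R]_(m, n)) (y : 'rV[R]_n) (c : 'M[R]_1) :
  minor_sum (block_mx A 0 y c) = minor_sum (col_mx A y) + minor_sum A * c 0 0.
Proof.
pose h1 (j : {ffun 'I_(m + 1) -> 'I_n}) : {ffun 'I_(m + 1) -> 'I_(n + 1)} :=
  [ffun k => lshift 1 (j k)].
pose h2 (j : {ffun 'I_m -> 'I_n}) : {ffun 'I_(m + 1) -> 'I_(n + 1)} :=
  [ffun k => match split k with
             | inl k' => lshift 1 (j k') | inr _ => rshift n ord0 end].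
have leS p (i : 'I_(p + 1)) : (i <= p)%N by have := ltn_ord i; lia.
have h1_inj : injective h1.
  move=> f g /ffunP fg; apply/ffunP => k; have := fg k; rewrite !ffunE.
  exact: lshift_inj.
have h2_inj : injective h2.
  move=> f g /ffunP fg; apply/ffunP => k; have := fg (lshift 1 k).
  by rewrite !ffunE (unsplitK (inl k)); exact: lshift_inj.
rewrite /minor_sum (bigID (fun j : {ffun 'I_(m + 1) -> 'I_(n + 1)} =>
  [forall k, (j k < n)%N])) /=.
congr (_ + _).
  rewrite (eq_bigl (mem [set h1 j | j in [set j | increasing (fun_of_fin j)]]));
    last first.
    move=> j; apply/andP/imsetP => [[jP /forallP jn]|[i + ->]].
      exists [ffun k => Ordinal (jn k)].
        rewrite inE; apply/increasingP => k l kl; rewrite !ffunE /=.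
        by move/increasingP: jP; apply.
      by apply/ffunP => k; rewrite !ffunE; apply/val_inj.
    rewrite inE => /increasingP iP; split; last first.
      by apply/forallP => k; rewrite ffunE /=.
    by apply/increasingP => k l kl; rewrite !ffunE; exact: iP.
  rewrite big_imset /=; last by move=> ? ? _ _; exact: h1_inj.
  apply: eq_big => j; first by rewrite inE.
  move=> _; congr (\det _); apply/matrixP => a b.
  by rewrite !mxE ffunE; case: splitP => k _; rewrite row_mxEl.
rewrite (eq_bigl (mem [set h2 j | j in [set j | increasing (fun_of_fin j)]]));
  last first.
  move=> j; apply/andP/imsetP => [[jP /forallPn [k kn]]|[i + ->]].
    have jkn : j k = n :> nat.
      by apply/eqP; rewrite eqn_leq leS leqNgt.
    have km : k = m :> nat.
      apply/eqP; rewrite eqn_leq leS leqNgt; apply/negP => km.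
      have mm : (m < m + 1)%N by rewrite addn1.
      have := increasingP _ jP k (Ordinal mm) km; rewrite jkn.
      by apply/negP; rewrite -leqNgt leS.
    have jn (k' : 'I_m) : (j (lshift 1 k') < n)%N.
      rewrite -[X in (_ < X)%N]jkn; apply: (increasingP _ jP).
      by rewrite [X in (_ < X)%N]km /=.
    exists [ffun k' => Ordinal (jn k')].
      rewrite inE; apply/increasingP => a b ab; rewrite !ffunE /=.
      exact: (increasingP _ jP).
    apply/ffunP => a; rewrite !ffunE; apply/val_inj; case: splitP => b ab /=.
      by rewrite ffunE /=; congr (val (j _)); apply/val_inj.
    rewrite (_ : a = k) ?jkn ?addn0 //; apply/val_inj.
    by rewrite /= ab km (ord1 b) addn0.
  rewrite inE => /increasingP iP; split.
    apply/increasingP => k l; rewrite !ffunE.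
    case: splitP => a ->; case: splitP => b -> /=.
    - exact: iP.
    - by rewrite addn0.
    - by move=> lt_; have := ltn_trans lt_ (ltn_ord b);
        rewrite ltnNge leq_addr.
    - by rewrite !ord1 ltnn.
  apply/forallPn; exists (rshift m ord0); rewrite ffunE.
  by rewrite (unsplitK (inr ord0)) /= addn0 ltnn.
rewrite big_imset /=; last by move=> ? ? _ _; exact: h2_inj.
rewrite big_distrl /=; apply: eq_big => j; first by rewrite inE.
move=> _; rewrite -det_mx11 -(det_lblock _ (colsub j y)).
congr (\det _); apply/matrixP => a b.
rewrite mxE -(splitK a) -(splitK b); case: (split a) (split b) => k [] l /=;
  rewrite !ffunE ?(unsplitK (inl l)) ?(unsplitK (inr l))
    ?(block_mxEul, block_mxEur, block_mxEdl, block_mxEdr) ?mxE // ord1.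
by rewrite (ord1 l).
Qed.

Lemma minor_sum_row_mx0 m n (A : 'M[R]_(m, n)) :
  minor_sum (row_mx A (0 : 'cV_m)) = minor_sum A.
Proof.
case: m A => [|m] A; first by rewrite !minor_sum0.
move: A; rewrite -[in m.+1]addn1 => A.
rewrite -{1}(vsubmxK A) -[X in row_mx _ X]vsubmxK !linear0 -block_mxEh.
by rewrite minor_sum_block vsubmxK mxE mulr0 addr0.
Qed.

Lemma minor_sum_row0 m n (A : 'M[R]_(m, n)) : minor_sum (col_mx A (0 : 'rV_n)) = 0.
Proof.
rewrite /minor_sum big1 // => j _.
rewrite (expand_det_row _ (rshift m ord0)) big1 // => k _.
by rewrite mxE col_mxEd mxE mul0r.
Qed.

(** Linearity in the last column, obtained through transposes because [determinant_multilinear]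
    speaks of rows. *)
Lemma det_block_last_col m (X : 'M[R]_m) (r : 'rV[R]_m) k l
    (p q : 'cV[R]_m) (s t : 'M[R]_1) :
  \det (block_mx X (k *: p + l *: q) r (k *: s + l *: t)) =
  k * \det (block_mx X p r s) + l * \det (block_mx X q r t).
Proof.
rewrite -[LHS]det_tr -[\det (block_mx X p r s)]det_tr
  -[\det (block_mx X q r t)]det_tr.
have lt_a (a : 'I_(m + 1).-1) : (a < m)%N by have := ltn_ord a; lia.
have liftE a : lift (rshift m ord0) a = lshift 1 (Ordinal (lt_a a)).
  by apply/val_inj; rewrite /= /bump addn0 leqNgt lt_a.
apply: (determinant_multilinear (i0 := rshift m ord0)).
- by apply/rowP => a; rewrite !mxE; case: (split a) => b; rewrite !row_mxEr !mxE.
- by apply/matrixP => a b; rewrite !mxE liftE; case: (split b) => b';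
    rewrite !row_mxEl.
- by apply/matrixP => a b; rewrite !mxE liftE; case: (split b) => b';
    rewrite !row_mxEl.
Qed.

End MinorSum.

Lemma minor_sum_map (R S : comPzRingType) (f : {rmorphism R -> S}) m n
    (A : 'M[R]_(m, n)) : minor_sum (map_mx f A) = f (minor_sum A).
Proof.
rewrite /minor_sum rmorph_sum; apply: eq_bigr => j _; rewrite -det_map_mx.
by congr (\det _); apply/matrixP => a b; rewrite !mxE.
Qed.

(** * The square of the sum of the maximal minors *)

Section Gram.
Context {R : comPzRingType}.

Definition ones n : 'cV[R]_n := const_mx 1.

Definition link_gram m n (A : 'M[R]_(m, n)) : 'M[R]_m :=
  A *m link_mx n *m A^T.

Lemma link_mx_block n :
  link_mx (n + 1) = block_mx (link_mx n) (2 *: ones n) 0 1%:M :> 'M[R]_(n + 1).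
Proof.
apply/matrixP => a b; rewrite -(splitK a) -(splitK b).
case: (split a) (split b) => k [] l /=; rewrite ?(block_mxEul, block_mxEur,
  block_mxEdl, block_mxEdr) !mxE //=.
- by rewrite (ord1 l) addn0 ltn_ord ltnW // mulr1.
- by rewrite (ord1 k) addn0 leqNgt ltn_ord ltnNge ltnW //= addr0.
- by rewrite !ord1 leqnn ltnn addr0.
Qed.

Lemma det_link_mx n : \det (link_mx n) = 1 :> R.
Proof.
elim: n => [|n IHn]; first by rewrite det_mx00.
by rewrite -addn1 link_mx_block det_ublock IHn det1 mulr1.
Qed.

Lemma link_mx_sym n :
  link_mx n + (link_mx n)^T = 2 *: (ones n *m (ones n)^T) :> 'M[R]_n.
Proof.
apply/matrixP => a b; rewrite !mxE big_ord1 !mxE !mulr1.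
by case: ltngtP => _ /=; ring.
Qed.

Lemma link_gram_sym m n (A : 'M[R]_(m, n)) :
  link_gram A + (link_gram A)^T = 2 *: (A *m ones n *m (A *m ones n)^T).
Proof.
rewrite /link_gram !trmx_mul trmxK mulmxA -mulmxDl -mulmxDr link_mx_sym.
by rewrite -scalemxAr -scalemxAl !mulmxA.
Qed.

Lemma link_gram_mulmx m n (g : 'M[R]_m) (A : 'M[R]_(m, n)) :
  \det (link_gram (g *m A)) = \det g ^+ 2 * \det (link_gram A).
Proof.
rewrite /link_gram trmx_mul -!mulmxA det_mulmx !mulmxA det_mulmx det_tr.
by ring.
Qed.

Lemma link_gram_row_mx m n (A : 'M[R]_(m, n)) (c : 'cV[R]_m) :
  link_gram (row_mx A c) = link_gram A + (2 *: (A *m ones n) + c) *m c^T.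
Proof.
rewrite /link_gram link_mx_block mul_row_block tr_row_mx mul_row_col.
by rewrite mulmx0 addr0 mulmx1 -scalemxAr.
Qed.

Lemma link_gram_col_mx m n (A : 'M[R]_(m, n)) (y : 'rV[R]_n) :
  link_gram (col_mx A y) =
  block_mx (link_gram A) (A *m link_mx n *m y^T)
           (y *m link_mx n *m A^T) (y *m link_mx n *m y^T).
Proof. by rewrite /link_gram mul_col_mx tr_col_mx mul_col_row. Qed.

(* Cramer's rule for the last coordinate. *)
Lemma adj_block_last m (X : 'M[R]_m) (r : 'rV[R]_m) (p q : 'cV[R]_m)
    (s t : 'M[R]_1) :
  (\adj (block_mx X p r s) *m col_mx q t) (rshift m ord0) 0 =
  \det (block_mx X q r t).
Proof.
rewrite mxE (expand_det_col _ (rshift m ord0)); apply: eq_bigr => k _.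
rewrite mulrC; congr (_ * _).
  rewrite -(splitK k); case: (split k) => i /=.
    by rewrite col_mxEu block_mxEur.
  by rewrite col_mxEd block_mxEdr.
rewrite mxE; congr (_ * \det _); apply/matrixP => a b; rewrite !mxE.
have lt_b : (b < m)%N by have := ltn_ord b; lia.
have -> : lift (rshift m ord0) b = lshift 1 (Ordinal lt_b).
  by apply/val_inj; rewrite /= /bump addn0 leqNgt lt_b.
by case: (split (lift _ _)) => i; rewrite !row_mxEl.
Qed.

(* The last column of [link_gram (col_mx A y)] replaced by [col_mx A y *m ones n]. *)
Definition bordered_det m n (A : 'M[R]_(m, n)) (y : 'rV[R]_n) : R :=
  \det (block_mx (link_gram A) (A *m ones n)
                 (y *m link_mx n *m A^T) (y *m ones n)).

(* Compare the last diagonal entries of [adj X * (X + X^T) * (adj X)^T]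
   computed in two ways. *)
Lemma bordered_det_sqr m n (A : 'M[R]_(m, n)) (y : 'rV[R]_n) :
  2 * bordered_det A y ^+ 2 =
  2 * (\det (link_gram (col_mx A y)) * \det (link_gram A)).
Proof.
set X := link_gram (col_mx A y); set l := rshift m (@ord0 0).
have wE : (\adj X *m (col_mx A y *m ones n)) l 0 = bordered_det A y.
  by rewrite /X link_gram_col_mx mul_col_mx adj_block_last.
have aE : \adj X l l = \det (link_gram A).
  have := adj_block_last (link_gram A) (y *m link_mx n *m A^T)
    (A *m link_mx n *m y^T) 0 (y *m link_mx n *m y^T) 1%:M.
  rewrite det_lblock det1 mulr1 -link_gram_col_mx -/X => <-.
  rewrite [RHS]mxE (bigD1 l) //= big1 ?addr0 => [|k].
    by rewrite col_mxEd [1%:M _ _]mxE mulr1.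
  rewrite -(splitK k); case: (split k) => i /=.
    by rewrite col_mxEu [X in _ * X]mxE mulr0.
  by rewrite (ord1 i) eqxx.
have : (\adj X *m (X + X^T) *m (\adj X)^T) l l =
    (2 *: (\adj X *m (col_mx A y *m ones n) *m
           (\adj X *m (col_mx A y *m ones n))^T)) l l.
  by rewrite link_gram_sym -scalemxAr -scalemxAl !trmx_mul !mulmxA.
rewrite mulmxDr mulmxDl mul_adj_mx -mulmxA -trmx_mul mul_adj_mx.
rewrite tr_scalar_mx mul_scalar_mx mul_mx_scalar.
rewrite [RHS]mxE [X in 2 * X]mxE big_ord1 [X in _ * (_ * X)]mxE wE.
rewrite mxE [X in X + _]mxE [X in _ + X]mxE [X in _ * X + _]mxE !aE => e.
by rewrite expr2 -e; ring.
Qed.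

(** The appended column is zero outside the last row, so by [link_gram_row_mx] only the last column
    of the Gram matrix changes, and the determinant is linear in it. *)
Lemma link_gram_block m n (A : 'M[R]_(m, n)) (y : 'rV[R]_n) (c : R) :
  \det (link_gram (block_mx A 0 y c%:M)) =
  \det (link_gram (col_mx A y)) + (2 * c) * bordered_det A y
    + c ^+ 2 * \det (link_gram A).
Proof.
rewrite block_mxEh link_gram_row_mx link_gram_col_mx mul_col_mx tr_col_mx.
rewrite trmx0 tr_scalar_mx scale_col_mx add_col_mx mul_col_row !mulmx0.
rewrite add_block_mx !addr0 !mul_mx_scalar scalerDr !scalerA [c * 2]mulrC addrA.
set p := A *m link_mx n *m y^T; set q := A *m ones n.
set s := y *m link_mx n *m y^T; set t := y *m ones n.
(* The unit coefficients give both blocks the shape that [det_block_last_col] splits twice. *)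
have -> : p + (2 * c) *: q = 1 *: (1 *: p + (2 * c) *: q) + c ^+ 2 *: 0.
  by rewrite !scale1r scaler0 addr0.
have -> : s + (2 * c) *: t + c *: c%:M = 1 *: (1 *: s + (2 * c) *: t) + c ^+ 2 *: 1%:M.
  by rewrite !scale1r !scale_scalar_mx mulr1.
by rewrite !det_block_last_col !mul1r det_lblock det1 mulr1.
Qed.

End Gram.

Lemma link_mx_map (R S : comPzRingType) (f : {rmorphism R -> S}) n :
  map_mx f (link_mx n) = link_mx n.
Proof. by apply/matrixP => a b; rewrite !mxE rmorphD !rmorph_nat. Qed.

Lemma link_gram_map (R S : comPzRingType) (f : {rmorphism R -> S}) m n
    (A : 'M[R]_(m, n)) : link_gram (map_mx f A) = map_mx f (link_gram A).
Proof. by rewrite /link_gram !map_mxM map_trmx link_mx_map. Qed.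

Lemma bordered_det_map (R S : comPzRingType) (f : {rmorphism R -> S}) m n
    (A : 'M[R]_(m, n)) (y : 'rV_n) :
  bordered_det (map_mx f A) (map_mx f y) = f (bordered_det A y).
Proof.
rewrite /bordered_det -det_map_mx map_block_mx -link_gram_map !map_mxM.
by rewrite map_trmx link_mx_map map_const_mx rmorph1.
Qed.

(** The domain is quantified inside because the induction step over [R] calls the induction
    hypotheses over [{poly R}]. *)
Definition minor_sum_sqr_in_domains m n : Prop :=
  forall R : idomainType, 2 != 0 :> R -> forall A : 'M[R]_(m, n),
    minor_sum A ^+ 2 = \det (link_gram A).

(** Supplies the base point at which the sign is tested. A new last row and column, zero except for
    a corner 1, leave the minor sum unchanged. *)
Lemma minor_sum_neq0 (R : comNzRingType) m n : (m <= n)%N ->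
  exists A : 'M[R]_(m, n), minor_sum A != 0.
Proof.
elim: m n => [|m IHm] [|n] //; try by exists 0; rewrite minor_sum0 oner_neq0.
rewrite ltnS => /IHm[A A0]; rewrite -addn1 -[n.+1]addn1.
exists (block_mx A 0 0 1%:M).
by rewrite minor_sum_block minor_sum_row0 add0r mxE mulr1.
Qed.

Section Step.
Variables m n : nat.
Hypothesis le_mn : (m <= n)%N.
Hypothesis IH0 : minor_sum_sqr_in_domains m n.
Hypothesis IH1 : minor_sum_sqr_in_domains m (n + 1).
Hypothesis IH2 : minor_sum_sqr_in_domains (m + 1) (n + 1).

Lemma bordered_det_eq_sign (R : idomainType) : 2 != 0 :> R ->
  forall (A : 'M[R]_(m, n + 1)) y,
  bordered_det A y = minor_sum (col_mx A y) * minor_sum A \/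
  bordered_det A y = - (minor_sum (col_mx A y) * minor_sum A).
Proof.
move=> R2 A y; have := bordered_det_sqr A y.
rewrite -IH1 // -IH2 // -exprMn => /(mulfI R2)/eqP.
by rewrite eqf_sqr => /orP[]/eqP; [left|right].
Qed.

(* The sign is constant along the line joining [A] to a matrix at which both
   sides are known and do not vanish. *)
Lemma bordered_det_eq (R : idomainType) : 2 != 0 :> R ->
  forall (A : 'M[R]_(m, n + 1)) y,
  bordered_det A y = minor_sum (col_mx A y) * minor_sum A.
Proof.
move=> R2 A y; have [E0 E0N0] := minor_sum_neq0 R le_mn.
(* At [E] and [z] both sides equal [minor_sum E0 ^+ 2], which is nonzero in a domain. *)
pose E := row_mx E0 (0 : 'cV_m); pose z : 'rV[R]_(n + 1) := row_mx 0 1%:M.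
have zE : bordered_det E z = minor_sum E0 ^+ 2.
  have gE : link_gram E = link_gram E0.
    by rewrite link_gram_row_mx trmx0 mulmx0 addr0.
  rewrite /bordered_det gE /E tr_row_mx link_mx_block mul_row_block.
  rewrite !mul0mx !mul1mx !add0r mul_row_col trmx0 mulmx0 mul0mx addr0.
  rewrite det_ublock -IH0 // det_mx11 [X in _ * X]mxE.
  rewrite big_split_ord big1 ?big_ord1 => [|i _].
    by rewrite /= row_mxEr !mxE !mulr1 add0r mulr1.
  by rewrite row_mxEl !mxE mul0r.
have zS : minor_sum (col_mx E z) = minor_sum E0.
  by rewrite -block_mxEv minor_sum_block minor_sum_row0 add0r mxE mulr1.
pose line p q (U V : 'M[R]_(p, q)) : 'M[{poly R}]_(p, q) :=
  map_mx polyC U + 'X *: map_mx polyC (V - U).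
have line0 p q (U V : 'M[R]_(p, q)) : map_mx (horner_eval 0) (line p q U V) = U.
  by apply/matrixP => i j; rewrite !mxE /horner_eval !hornerE.
have line1 p q (U V : 'M[R]_(p, q)) : map_mx (horner_eval 1) (line p q U V) = V.
  apply/matrixP => i j; rewrite !mxE /horner_eval !hornerE /=.
  by rewrite addrC addKr.
have P2 : 2 != 0 :> {poly R} by rewrite -polyC_natr polyC_eq0.
(* Over the domain [{poly R}] one sign holds along the whole line. With a plus sign, evaluation at 1
   yields the claim; a minus sign would give [2 * minor_sum E0 ^+ 2 = 0] at 0. *)
have [e|/(congr1 (horner_eval 0))] :=
  bordered_det_eq_sign P2 (line _ _ E A) (line _ _ z y).
  rewrite -[A](line1 _ _ E) -[y](line1 _ _ z) bordered_det_map e rmorphM.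
  by rewrite -map_col_mx !minor_sum_map.
rewrite rmorphN rmorphM -bordered_det_map -!minor_sum_map map_col_mx !line0.
rewrite zE zS minor_sum_row_mx0 => /eqP; rewrite -addr_eq0 -mulr2n -mulr_natl.
by rewrite mulf_eq0 (negPf R2) expf_eq0 (negPf E0N0).
Qed.

Lemma minor_sum_sqr_step : minor_sum_sqr_in_domains (m + 1) (n + 1 + 1).
Proof.
have red (R : idomainType) : 2 != 0 :> R -> forall (A : 'M[R]_(m + 1, n + 1 + 1)),
  A (rshift m 0) (rshift (n + 1) 0) != 0 -> minor_sum A ^+ 2 = \det (link_gram A).
  move=> R2 A; rewrite -(submxK A) block_mxEdr [drsubmx A]mx11_scalar.
  move: (drsubmx A 0 0) (ursubmx A) => c b; rewrite mxE eqxx mulr1n => c0.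
  (* Left multiplication by [g] clears the last column above the corner [c]. It multiplies both
     sides by the square of [\det g], a power of [c], which can be cancelled. *)
  pose g := block_mx c%:M (- b) 0 1%:M.
  have g0 : \det g != 0 by rewrite det_ublock det1 det_scalar mulr1 expf_neq0.
  have /mulfI := expf_neq0 2 g0; apply.
  rewrite -exprMn -minor_sum_mulmx -link_gram_mulmx /g mulmx_block.
  rewrite !mul0mx !add0r !mul1mx mul_mx_scalar !mul_scalar_mx scalerN subrr.
  rewrite minor_sum_block link_gram_block bordered_det_eq // -IH1 // -IH2 //.
  by rewrite mxE eqxx mulr1n; ring.
move=> R R2 A.
(* Adding ['X] to the corner entry makes it a nonzero polynomial, so [red] applies over [{poly R}];
   evaluation at 0 returns to [A]. *)
pose B := map_mx polyC A +
  'X *: delta_mx (rshift m 0) (rshift (n + 1) 0).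
have B0 : map_mx (horner_eval 0) B = A.
  by apply/matrixP => i j; rewrite !mxE /horner_eval !hornerE.
have P2 : 2 != 0 :> {poly R} by rewrite -polyC_natr polyC_eq0.
rewrite -B0 minor_sum_map link_gram_map det_map_mx -rmorphXn red //.
by rewrite !mxE !eqxx mulr1 addrC -size_poly_eq0 size_XaddC.
Qed.

End Step.

Lemma minor_sum_sqr_domain m n : (m <= n)%N -> minor_sum_sqr_in_domains m n.
Proof.
(* Strong induction on the number of columns; square matrices are treated directly, since [link_mx]
   has determinant 1. *)
elim/ltn_ind: n m => -[|n] IHn [|m] // le_mn R R2 A;
  try by rewrite minor_sum0 det_mx00 expr1n.
have [eq_mn|lt_mn] := eqVneq m n.
  move: A; rewrite eq_mn => A; rewrite minor_sum_square /link_gram !det_mulmx.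
  by rewrite det_tr det_link_mx mulr1 -expr2.
case: n => [|n] in IHn A le_mn lt_mn *; first by case: m lt_mn le_mn A.
have {le_mn lt_mn} le_mn : (m <= n)%N by lia.
move: A; rewrite -[m.+1]addn1 -[n.+2]addn1 -[n.+1]addn1.
apply: minor_sum_sqr_step => //; rewrite ?addn1; apply: IHn; lia.
Qed.

(** The domain is an iterated polynomial ring over [int], with one variable sent to each element of
    [xs]. Applied to the entries of a matrix, it lifts the matrix to a domain where [2 != 0]. *)
Lemma idomain_cover (K : comNzRingType) (xs : seq K) :
  exists (R : idomainType) (f : {rmorphism R -> K}),
    2 != 0 :> R /\ {in xs, forall x, exists a, f a = x}.
Proof.
elim: xs => [|x xs [R [f [R2 fP]]]]; first by exists int, (intmul 1).
have cfx : commr_rmorph f x by move=> a; exact: mulrC.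
exists {poly R}, (horner_morph cfx); split => [|y].
  by rewrite -polyC_natr polyC_eq0.
rewrite inE => /predU1P[->|/fP[a <-]]; first by exists 'X; exact: horner_morphX.
by exists a%:P; exact: horner_morphC.
Qed.

Lemma minor_sum_sqr_nz (K : comNzRingType) m n (A : 'M[K]_(m, n)) :
  (m <= n)%N -> minor_sum A ^+ 2 = \det (link_gram A).
Proof.
move=> le_mn.
have [R [f [R2 fP]]] := idomain_cover [seq A i j | i <- enum 'I_m, j <- enum 'I_n].
have fA i j : exists a, f a == A i j.
  by have [|a <-] := fP (A i j); [rewrite allpairs_f ?mem_enum | exists a].
have -> : A = map_mx f (\matrix_(i, j) xchoose (fA i j)).
  by apply/matrixP => i j; rewrite !mxE (eqP (xchooseP (fA i j))).
by rewrite minor_sum_map link_gram_map det_map_mx -rmorphXn minor_sum_sqr_domain.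
Qed.

Lemma minor_sum_sqr (K : comPzRingType) m n (A : 'M[K]_(m, n)) :
  (m <= n)%N -> minor_sum A ^+ 2 = \det (link_gram A).
Proof.
(* In the zero ring any two elements agree; otherwise [K] is repackaged as a nonzero ring, for which
   [minor_sum_sqr_nz] is stated. *)
move=> le_mn; have [K0|K1] := eqVneq (1 : K) 0.
  by rewrite -[LHS]mulr1 -[RHS]mulr1 K0 !mulr0.
pose nzM := GRing.PzSemiRing_isNonZero.Build K K1.
pose K' : comNzRingType := HB.pack (GRing.ComPzRing.sort K) nzM.
exact: (@minor_sum_sqr_nz K').
Qed.

From mathcomp Require Import all_classical all_reals all_analysis.
Local Open Scope classical_set_scope.
Local Open Scope ring_scope.

(** * Walks and exchange of initial segments *)

Section Walks.
Context {K : comPzRingType} {H : wdigraph K}.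
Implicit Types (x y z : vert H) (s : seq (edge H)) (p q : gpath H).

Lemma walk_cat x s1 s2 y :
  walk x (s1 ++ s2) y <-> exists2 z, walk x s1 z & walk z s2 y.
Proof.
elim: s1 x => [|e s1 IH] x /=; first by split => [?|[z ->]]; [exists x|].
split=> [[ex /IH[z ? ?]]|[z [ex ?] ?]]; first by exists z.
by split=> //; apply/IH; exists z.
Qed.

Lemma walk_last x s y : walk x s y -> last x [seq tgt e | e <- s] = y.
Proof. by elim: s x => [|e s IH] x //= [_ /IH]. Qed.

(** For the mirror half of a path, whose reversed edges end at the original sources. *)
Lemma walk_src x s y : walk x s y ->
  x :: [seq tgt e | e <- s] = rcons [seq src e | e <- s] y.
Proof. by elim: s x => [|e s IH] x /= => [->|[<- /IH ->]]. Qed.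

Lemma walk_split x s y z : walk x s y -> z \in x :: [seq tgt e | e <- s] ->
  let i := index z (x :: [seq tgt e | e <- s]) in
  walk x (take i s) z /\ walk z (drop i s) y.
Proof.
elim: s x => [|e s IH] x /=.
  by move=> <-; rewrite inE => /eqP ->.
move=> [ex wk]; rewrite inE; case: (eqVneq x z) => [<- _|xz /= zin] //=.
by have [? ?] := IH _ wk zin.
Qed.

Lemma acyclic_uniq x s y : acyclic H -> walk x s y ->
  uniq (x :: [seq tgt e | e <- s]).
Proof.
move=> Hac; elim: s x => [|e s IH] x //= [ex wk].
rewrite -[X in _ && X]/(uniq (tgt e :: [seq tgt e | e <- s])) IH // andbT.
apply/negP => /(walk_split wk)[wx _].
by have := Hac x (e :: take (index x (tgt e :: [seq tgt e | e <- s])) s)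
  (conj ex wx).
Qed.

(** The vertex list starts with the initial vertex, so for [z] on [p] this is also the number of
    edges before the first visit to [z]. *)
Definition cut z p := index z (path_verts p).

(** The tail is that of [p], so exchanging two paths keeps the end vertices in place and permutes
    only the initial ones. *)
Definition swap_head z p q : gpath H :=
  (q.1, take (cut z q) q.2 ++ drop (cut z p) p.2).

Lemma swap_head_path z p q x y x' y' : z \in path_verts p ->
  z \in path_verts q -> paths x y p -> paths x' y' q ->
  paths x' y (swap_head z p q).
Proof.
move: p q => [p1 p] [q1 q] zp zq [/= p1E wp] [/= q1E wq]; subst.
split=> //=; apply/walk_cat; exists z.
  by have [] := walk_split wq zq.
by have [] := walk_split wp zp.
Qed.

Lemma path_verts_swap_head z p q :
  path_verts (swap_head z p q) =
  take (cut z q).+1 (path_verts q) ++ drop (cut z p).+1 (path_verts p).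
Proof. by rewrite /path_verts /= map_cat map_take map_drop. Qed.

Lemma mem_swap_head z p q : z \in path_verts p -> z \in path_verts q ->
  z \in path_verts (swap_head z p q).
Proof.
move=> zp zq; rewrite path_verts_swap_head mem_cat.
by rewrite in_take // leqnn.
Qed.

Lemma cut_swap_head z p q : z \in path_verts p -> z \in path_verts q ->
  cut z (swap_head z p q) = cut z q.
Proof.
move=> zp zq; rewrite /cut path_verts_swap_head index_cat.
have zt : z \in take (cut z q).+1 (path_verts q).
  by rewrite in_take // leqnn.
rewrite zt -[in RHS](cat_take_drop (cut z q).+1 (path_verts q)).
by rewrite index_cat zt.
Qed.

Lemma swap_headK z p q : z \in path_verts p -> z \in path_verts q ->
  swap_head z (swap_head z p q) (swap_head z q p) = p.
Proof.
move=> zp zq; have le_cut r : z \in path_verts r -> (cut z r <= size r.2)%N.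
  by rewrite -index_mem /= size_map ltnS.
rewrite {1}/swap_head !cut_swap_head // /swap_head /=.
rewrite take_size_cat ?size_takel ?le_cut // drop_size_cat ?size_takel ?le_cut //.
by rewrite cat_take_drop; case: p {zp le_cut}.
Qed.

Lemma count_swap_head z p q y :
  (count_mem y (path_verts (swap_head z p q)) +
   count_mem y (path_verts (swap_head z q p)) =
   count_mem y (path_verts p) + count_mem y (path_verts q))%N.
Proof.
rewrite !path_verts_swap_head !count_cat.
rewrite -[in RHS](cat_take_drop (cut z p).+1 (path_verts p)).
rewrite -[in RHS](cat_take_drop (cut z q).+1 (path_verts q)) !count_cat.
lia.
Qed.

Lemma path_wt_swap_head z p q :
  path_wt (swap_head z p q) * path_wt (swap_head z q p) =
  path_wt p * path_wt q.
Proof.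
rewrite /path_wt /= !big_cat /=.
rewrite -[in RHS](cat_take_drop (cut z p) p.2).
rewrite -[in RHS](cat_take_drop (cut z q) q.2).
by rewrite !big_cat /=; ring.
Qed.

End Walks.

(** * Lindstrom's lemma *)

Section SwapHeads.
Context {K : comPzRingType} {H : wdigraph K} {m : nat}.
Implicit Types (P : {ffun 'I_m -> gpath H}) (x : vert H) (k l : 'I_m).

Definition through P x : {set 'I_m} := [set k | x \in path_verts (P k)].

Definition shared P : pred (vert H) := fun x => (1 < #|through P x|)%N.

Definition some_vertex (S : pred (vert H)) : option (vert H) :=
  if pselect (exists x, S x) is left exS then Some (xchoose exS) else None.

Definition two_in (I : {set 'I_m}) : option ('I_m * 'I_m) :=
  [pick kl : 'I_m * 'I_m | [&& kl.1 \in I, kl.2 \in I & kl.1 != kl.2]].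

Definition swap_heads_at x k l P : {ffun 'I_m -> gpath H} :=
  [ffun i => if i == k then swap_head x (P k) (P l)
             else if i == l then swap_head x (P l) (P k) else P i].

(* The set of shared vertices and the set of paths through the chosen vertex are
   invariant under the swap, so choosing the vertex and the two paths as
   functions of these sets makes the swap an involution. *)
Definition swap_heads (sP : 'S_m * {ffun 'I_m -> gpath H}) :
    'S_m * {ffun 'I_m -> gpath H} :=
  if some_vertex (shared sP.2) is Some x then
    if two_in (through sP.2 x) is Some (k, l) then
      ((tperm k l * sP.1)%g, swap_heads_at x k l sP.2)
    else sP
  else sP.

Lemma in_through P x k : (k \in through P x) = (x \in path_verts (P k)).
Proof. by rewrite finset.in_set. Qed.

Lemma nonintersectingPn P :
  ~ nonintersecting P <-> exists x, shared P x.
Proof.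
split=> [/existsNP[k /existsNP[l /not_implyP[kl /contrapT[x xk xl]]]]|[x]].
  by exists x; apply/card_gt1P; exists k, l; rewrite !in_through.
move=> /card_gt1P[k [l]]; rewrite !in_through => -[xk xl kl] /(_ k l kl); apply.
by exists x.
Qed.

Lemma swap_heads_atK x k l P : k != l -> k \in through P x ->
  l \in through P x -> swap_heads_at x k l (swap_heads_at x k l P) = P.
Proof.
rewrite !in_through => kl xk xl; apply/ffunP => i; rewrite !ffunE eqxx.
rewrite [l == k]eq_sym (negPf kl) eqxx.
case: eqP => [->|_]; first by rewrite swap_headK.
by case: eqP => [->|_] //; rewrite swap_headK.
Qed.

Lemma through_swap_heads_at x k l P : k \in through P x ->
  l \in through P x -> through (swap_heads_at x k l P) x = through P x.
Proof.
rewrite !in_through => xk xl; apply/setP => i; rewrite !in_through ffunE.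
by case: eqP => [->|_]; [|case: eqP => [->|_] //]; rewrite mem_swap_head.
Qed.

(** Turns the number of paths through [x] into a sum of multiplicities, which [count_swap_head]
    shows to be preserved by a swap. Acyclicity will provide the simplicity of the paths. *)
Lemma card_through P x : (forall i, uniq (path_verts (P i))) ->
  #|through P x| = (\sum_i count_mem x (path_verts (P i)))%N.
Proof.
move=> Pu; rewrite -sum1_card big_mkcond; apply: eq_bigr => i _.
by rewrite in_through count_uniq_mem //; case: (x \in path_verts (P i)).
Qed.

Lemma shared_swap_heads_at x k l P : k != l -> k \in through P x ->
  l \in through P x -> (forall i, uniq (path_verts (P i))) ->
  (forall i, uniq (path_verts (swap_heads_at x k l P i))) ->
  shared (swap_heads_at x k l P) = shared P.
Proof.
rewrite !in_through => kl xk xl Pu P'u; apply/funext => y; rewrite /shared.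
have split2 (F : 'I_m -> nat) : (\sum_i F i =
    F k + F l + \sum_(i | (i != k) && (i != l)) F i)%N.
  by rewrite (bigD1 k) //= (bigD1 l) 1?eq_sym //= addnA.
rewrite !card_through // !split2.
rewrite !ffunE eqxx [l == k]eq_sym (negPf kl) eqxx count_swap_head //.
congr (1 < _ + _)%N; apply: eq_bigr => i /andP[ik il].
by rewrite ffunE (negPf ik) (negPf il).
Qed.

Lemma tuple_wt_swap_heads_at x k l P : k != l ->
  tuple_wt (swap_heads_at x k l P) = tuple_wt P.
Proof.
move=> kl; have split2 (F : 'I_m -> K) : \prod_i F i =
    F k * F l * \prod_(i | (i != k) && (i != l)) F i.
  by rewrite (bigD1 k) //= (bigD1 l) 1?eq_sym //= mulrA.
rewrite /tuple_wt !split2.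
rewrite !ffunE eqxx [l == k]eq_sym (negPf kl) eqxx path_wt_swap_head.
congr (_ * _); apply: eq_bigr => i /andP[ik il].
by rewrite ffunE (negPf ik) (negPf il).
Qed.

Variables (a b : 'I_m -> vert H).
Hypothesis H_acyclic : acyclic H.

Definition tuples (s : 'S_m) : set {ffun 'I_m -> gpath H} :=
  [set P | forall k, paths (a (s k)) (b k) (P k)].

Lemma tuples_uniq s P : tuples s P -> forall i, uniq (path_verts (P i)).
Proof.
by move=> sP i; have [e] := sP i; rewrite /path_verts e; exact: acyclic_uniq.
Qed.

Lemma tuples_swap_heads_at s x k l P : k != l -> k \in through P x ->
  l \in through P x -> tuples s P ->
  tuples (tperm k l * s)%g (swap_heads_at x k l P).
Proof.
(* In the product the transposition acts first, so path [k] receives the initial vertex of path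
   [l]. *)
rewrite !in_through => kl xk xl sP i; rewrite permM ffunE.
case: (eqVneq i k) => [->|ik].
  rewrite tpermL; exact: swap_head_path (sP k) (sP l).
case: (eqVneq i l) => [->|il].
  rewrite tpermR; exact: swap_head_path (sP l) (sP k).
by rewrite tpermD 1?eq_sym.
Qed.

Lemma swap_headsP s P : tuples s P -> ~ nonintersecting P ->
  [/\ tuples (swap_heads (s, P)).1 (swap_heads (s, P)).2,
      ~ nonintersecting (swap_heads (s, P)).2,
      tuple_wt (swap_heads (s, P)).2 = tuple_wt P,
      odd_perm (swap_heads (s, P)).1 = ~~ odd_perm s &
      swap_heads (swap_heads (s, P)) = (s, P)].
Proof.
move=> sP /nonintersectingPn exS.
have [x xS eq_x] : exists2 x, shared P x & some_vertex (shared P) = Some x.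
  rewrite /some_vertex; case: pselect => // exS'.
  by exists (xchoose exS') => //; exact: xchooseP.
have [[k l] /= /and3P[xk xl kl] eq_kl] :
    exists2 kl : 'I_m * 'I_m, [&& kl.1 \in through P x, kl.2 \in through P x
      & kl.1 != kl.2] & two_in (through P x) = Some kl.
  rewrite /two_in; case: pickP => [kl klP|nokl]; first by exists kl.
  have /card_gt1P[k [l [xk xl kl]]] := xS.
  by have := nokl (k, l); rewrite /= xk xl kl.
have eq_sw : swap_heads (s, P) = ((tperm k l * s)%g, swap_heads_at x k l P).
  by rewrite /swap_heads /= eq_x eq_kl.
have s'P' := tuples_swap_heads_at kl xk xl sP.
have sh := shared_swap_heads_at kl xk xl (tuples_uniq sP) (tuples_uniq s'P').
rewrite eq_sw /=; split => //.
- by apply/nonintersectingPn; rewrite sh.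
- exact: tuple_wt_swap_heads_at.
- by rewrite odd_permM odd_tperm kl.
- rewrite /swap_heads /= sh eq_x through_swap_heads_at // eq_kl.
  by rewrite mulgA tperm2 mul1g swap_heads_atK.
Qed.

End SwapHeads.

Definition path_gf (K : comPzRingType) (H : wdigraph K) (x y : vert H) : K :=
  \sum_(p \in paths x y) path_wt p.

Lemma fsum_seqE (K : comPzRingType) (T : choiceType) (A : set T) (r : seq T)
    (F : T -> K) : uniq r -> (forall x, x \in r -> A x) ->
  (forall x, A x -> F x != 0 -> x \in r) ->
  \sum_(x \in A) F x = \sum_(x <- r) F x.
Proof.
move=> ru rA Ar; rewrite (fsbigE r) // => [|x Ax]; last first.
  by apply: contraNeq => /(Ar x Ax).
rewrite big_seq_cond [RHS]big_seq_cond; apply: eq_bigl => x.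
by case xr: (x \in r) => //=; apply/mem_set/rA.
Qed.

(** [phi] matches the odd terms with the even ones. Reindexing the whole sum by [phi] would only
    show that twice the sum vanishes, which is too weak when 2 is a zero divisor. *)
Lemma big_involution_sign (K : comPzRingType) (T : eqType) (E : seq T)
    (sg : T -> bool) (w : T -> K) (phi : T -> T) :
  uniq E -> {in E, forall t, phi t \in E} -> {in E, forall t, phi (phi t) = t} ->
  {in E, forall t, w (phi t) = w t} -> {in E, forall t, sg (phi t) = ~~ sg t} ->
  \sum_(t <- E) (-1) ^+ sg t * w t = 0.
Proof.
move=> Eu phiE phiK phiw phisg; rewrite (bigID sg) /=.
have -> : \sum_(t <- E | sg t) (-1) ^+ sg t * w t = - \sum_(t <- E | sg t) w t.
  by rewrite -sumrN; apply: eq_bigr => t ->; rewrite mulN1r.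
have -> : \sum_(t <- E | ~~ sg t) (-1) ^+ sg t * w t = \sum_(t <- E | ~~ sg t) w t.
  by apply: eq_bigr => t /negPf ->; rewrite mul1r.
rewrite -[X in - X]big_filter.
rewrite (perm_big [seq phi t | t <- E & ~~ sg t]) /=; last first.
  apply: uniq_perm; first exact: filter_uniq.
    rewrite map_inj_in_uniq ?filter_uniq // => t u.
    rewrite !mem_filter => /andP[_ tE] /andP[_ uE] e.
    by rewrite -(phiK _ tE) e phiK.
  move=> t; rewrite mem_filter; apply/andP/mapP => [[st tE]|[u]].
    by exists (phi t); rewrite ?phiK // mem_filter phisg // negbK st phiE.
  by rewrite mem_filter => /andP[su uE] ->; rewrite phisg // phiE.
rewrite big_map big_filter addrC; apply/eqP; rewrite subr_eq0; apply/eqP.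
by rewrite big_seq_cond [RHS]big_seq_cond; apply: eq_bigr => t /andP[/phiw ->].
Qed.

Lemma paths_support (K : comPzRingType) (H : wdigraph K) m
    (a b : 'I_m -> vert H) : (forall i j, GF_defined (paths (a i) (b j))) ->
  exists r : seq (gpath H), forall i j p,
    paths (a i) (b j) p -> path_wt p != 0 -> p \in r.
Proof.
move=> fin.
have /finite_seqP[r rP] : finite_set (\bigcup_(ij in [set: 'I_m * 'I_m])
    (paths (a ij.1) (b ij.2) `&` [set p | path_wt p != 0])).
  by apply: bigcup_finite => // -[i j] _; exact: fin.
exists r => i j p ap wp.
by have : [set` r] p by rewrite -rP; exists (i, j).
Qed.

Lemma tuples_finite (K : comPzRingType) (H : wdigraph K) m
    (a b : 'I_m -> vert H) (s : 'S_m) :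
  (forall i j, GF_defined (paths (a i) (b j))) ->
  finite_set (tuples a b s `&` [set P | tuple_wt P != 0]).
Proof.
move=> fin.
have [r in_r] := paths_support fin.
pose T : finType := seq_sub r.
pose tup (g : {ffun 'I_m -> T}) : {ffun 'I_m -> gpath H} := [ffun k => val (g k)].
apply: (@sub_finite_set _ _ (tup @` [set: {ffun 'I_m -> T}])); last first.
  exact/finite_image/finite_finset.
move=> P [sP wP]; have Pr k : P k \in r.
  apply: in_r (sP k) _; apply: contra_neq wP => wk.
  by rewrite /tuple_wt (bigD1 k) //= wk mul0r.
exists [ffun k => SeqSub (Pr k)] => //.
by apply/ffunP => k; rewrite !ffunE.
Qed.

(** Expanding the determinant gives the signed sum over all tuples, and the intersecting ones cancel
    in pairs under [swap_heads]. *)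
Lemma lindstrom (K : comPzRingType) (H : wdigraph K) m (a b : 'I_m -> vert H) :
  acyclic H -> (forall i j, GF_defined (paths (a i) (b j))) ->
  \sum_(s : 'S_m) (-1) ^+ s * GF (P0fix a b s) =
  \det (\matrix_(i, j) path_gf (a i) (b j)).
Proof.
move=> Hac fin.
have [r in_r] := paths_support fin.
(* A tuple of nonzero weight has all its paths in the finite type [T], so sums over tuples become
   sums over [{ffun 'I_m -> T}]. *)
pose T : finType := seq_sub r; pose tup (g : {ffun 'I_m -> T}) := [ffun k => val (g k)].
have tup_inj : injective tup.
  move=> g h /ffunP gh; apply/ffunP => k; apply/val_inj.
  by have := gh k; rewrite !ffunE.
have tupE (s : 'S_m) P : tuples a b s P -> tuple_wt P != 0 -> exists g, P = tup g.
  move=> sP wP; have Pr k : P k \in r.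
    apply: in_r (sP k) _; apply: contra_neq wP => wk.
    by rewrite /tuple_wt (bigD1 k) //= wk mul0r.
  by exists [ffun k => SeqSub (Pr k)]; apply/ffunP => k; rewrite !ffunE.
have gfE i j : path_gf (a i) (b j) =
    \sum_(p : T | `[< paths (a i) (b j) (val p) >]) path_wt (val p).
  rewrite /path_gf (fsum_seqE (r := [seq val p | p <- index_enum T &
    `[< paths (a i) (b j) (val p) >]])).
  - by rewrite big_map big_filter.
  - by rewrite map_inj_uniq ?filter_uniq ?index_enum_uniq //; exact: val_inj.
  - by move=> p /= /mapP[q]; rewrite mem_filter => /andP[/asboolP ? _] ->.
  move=> p ap wp; apply/mapP.
  exists (SeqSub (in_r _ _ _ ap wp)) => //.
  by rewrite mem_filter mem_index_enum andbT; apply/asboolP.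
have GFE (s : 'S_m) : GF (P0fix a b s) =
    \sum_(g : {ffun 'I_m -> T} | `[< tuples a b s (tup g) >]
       && `[< nonintersecting (tup g) >]) tuple_wt (tup g).
  pose Q g := `[< tuples a b s (tup g) >] && `[< nonintersecting (tup g) >].
  rewrite /GF (fsum_seqE (r := [seq tup g | g <- index_enum {ffun 'I_m -> T} & Q g])).
  - by rewrite big_map big_filter.
  - by rewrite map_inj_uniq ?filter_uniq ?index_enum_uniq.
  - move=> p /= /mapP[q]; rewrite mem_filter => /andP[/andP[]] /asboolP sq.
    by move=> /asboolP nq _ ->; split.
  move=> P [nP sP] wP; apply/mapP.
  have [g gE] := tupE s P sP wP; exists g => //.
  by rewrite mem_filter mem_index_enum andbT /Q -gE; apply/andP; split; apply/asboolP.
have detE : \det (\matrix_(i, j) path_gf (a i) (b j)) = \sum_(s : 'S_m)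
    (-1) ^+ s * \sum_(g : {ffun 'I_m -> T} | `[< tuples a b s (tup g) >])
                 tuple_wt (tup g).
  (* The transpose makes the permutation act on the initial vertices, as it does in [tuples]. *)
  rewrite -det_tr; apply: eq_bigr => s _; congr (_ * _).
  under eq_bigr do rewrite !mxE gfE.
  rewrite bigA_distr_big_dep /=; apply: eq_big => [g|g _].
    by apply/familyP/asboolP => sg k; have := sg k; rewrite inE ffunE.
  by rewrite /tuple_wt; apply: eq_bigr => k _; rewrite ffunE.
(* Nonzero weight is preserved by the swap and keeps the paths within [r]; hence the finite list [E]
   is closed under [swap_heads]. *)
pose B (sP : 'S_m * {ffun 'I_m -> gpath H}) := [&& `[< tuples a b sP.1 sP.2 >],
  ~~ `[< nonintersecting sP.2 >] & tuple_wt sP.2 != 0].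
pose E := [seq sP <- [seq (sg.1, tup sg.2) | sg <-
  index_enum ('S_m * {ffun 'I_m -> T})%type] | B sP].
have EP sP : (sP \in E) = B sP.
  rewrite mem_filter; case BsP : (B sP) => //=; apply/mapP.
  move: BsP => /and3P[/asboolP tP _ wP]; have [g gE] := tupE _ _ tP wP.
  by exists (sP.1, g); rewrite ?mem_index_enum //= -gE -surjective_pairing.
have /(congr1 (fun z => \sum_(s : 'S_m) (-1) ^+ s * GF (P0fix a b s) + z)) :
    \sum_(sP <- E) (-1) ^+ odd_perm sP.1 * tuple_wt sP.2 = 0.
  apply: (big_involution_sign (sg := fun sP => odd_perm sP.1)
    (w := fun sP => tuple_wt sP.2) (phi := swap_heads)).
  - rewrite filter_uniq // map_inj_uniq ?index_enum_uniq // => -[s g] [s' g'] /= [-> gg].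
    by rewrite (tup_inj _ _ gg).
  - move=> [s P]; rewrite !EP => /and3P[/asboolP /= sP /asboolP nP wP].
    have [sP' nP' wE _ _] := swap_headsP Hac sP nP; apply/and3P; split.
    - exact/asboolP. - exact/asboolP. - by rewrite wE.
  - move=> [s P]; rewrite !EP => /and3P[/asboolP /= sP /asboolP nP wP].
    by have [] := swap_headsP Hac sP nP.
  - move=> [s P]; rewrite !EP => /and3P[/asboolP /= sP /asboolP nP wP].
    by have [] := swap_headsP Hac sP nP.
  - move=> [s P]; rewrite !EP => /and3P[/asboolP /= sP /asboolP nP wP].
    by have [] := swap_headsP Hac sP nP.
rewrite addr0 => <-; rewrite detE.
rewrite big_filter big_map /=.
rewrite [RHS](eq_bigr (fun s : 'S_m => (-1) ^+ s * GF (P0fix a b s) + (-1) ^+ s *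
   \sum_(g : {ffun 'I_m -> T} | B (s, tup g)) tuple_wt (tup g))) => [|s _].
  rewrite big_split /=; congr (_ + _).
  under [RHS]eq_bigr do rewrite big_distrr.
  by rewrite pair_big_dep.
rewrite -mulrDr GFE; congr (_ * _).
rewrite (bigID (fun g => `[< nonintersecting (tup g) >])) /=; congr (_ + _).
rewrite big_mkcond [RHS]big_mkcond; apply: eq_bigr => g _; rewrite /B /= andbA.
by case: (_ && _) => //=; case: eqP.
Qed.

(** * Paths in the symmetric graphs *)

Section LinkedGraph.
Context {K : comPzRingType} {G : wdigraph K} {n : nat} (v : 'I_n -> vert G).
Variables h1 h2 : consec n -> 'I_n.

Implicit Types (x y z : vert G) (p q : seq (edge G)).

(* [Gbar] and [Gtilde] are the instances [h1, h2 := consec_fst, consec_snd] and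
   [h1, h2 := consec_snd, consec_fst]. *)
Definition Glink : wdigraph K :=
  @add_edges K (Gsym G) (new_edge n)
    (fun e => match e with
              | inl (inl i) => inl (v i)
              | inl (inr c) => inl (v (h1 c))
              | inr c => inr (v (h1 c))
              end)
    (fun e => match e with
              | inl (inl i) => inr (v i)
              | inl (inr c) => inr (v (h2 c))
              | inr c => inr (v (h2 c))
              end).

(** The added edges that lead from [G] to its mirror image, straight ones and diagonal ones. *)
Definition crossing : finType := ('I_n + consec n)%type.

Definition cross_src (f : crossing) : 'I_n :=
  match f with inl i => i | inr c => h1 c end.
Definition cross_tgt (f : crossing) : 'I_n :=
  match f with inl i => i | inr c => h2 c end.

Fixpoint chain (a : 'I_n) (l : seq (consec n)) (b : 'I_n) : Prop :=
  if l is c :: l' then h1 c = a /\ chain (h2 c) l' b else a = b.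

Definition edgeL (e : edge G) : edge Glink := inl (inl e).
Definition edgeR (e : edge G) : edge Glink := inl (inr e).
Definition edgeC (c : consec n) : edge Glink := inr (inr c).
Definition edgeX (f : crossing) : edge Glink := inr (inl f).

(** Normal form of a path from [G] to its mirror image; [q] is a path of [G] traversed backwards. *)
Definition assemble (p : seq (edge G)) (f : crossing) (l : seq (consec n))
    (q : seq (edge G)) : seq (edge Glink) :=
  map edgeL p ++ edgeX f :: map edgeC l ++ map edgeR (rev q).

Lemma src_edgeX f : src (edgeX f) = inl (v (cross_src f)). Proof. by case: f. Qed.
Lemma tgt_edgeX f : tgt (edgeX f) = inr (v (cross_tgt f)). Proof. by case: f. Qed.

Lemma walk_edgeL x p y : walk x p y ->
  walk (inl x : vert Glink) (map edgeL p) (inl y).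
Proof.
by elim: p x => [|e p IH] x /= => [->|[ex /IH wk]] //; split=> //; rewrite ex.
Qed.

Lemma walk_edgeR x p y : walk x p y ->
  walk (inr y : vert Glink) (map edgeR (rev p)) (inr x).
Proof.
elim: p x => [|e p IH] x /= => [->|[ex /IH wk]] //.
rewrite rev_cons map_rcons -cats1; apply/walk_cat; exists (inr (tgt e)) => //=.
by rewrite ex.
Qed.

Lemma walk_edgeC a l b : chain a l b ->
  walk (inr (v a) : vert Glink) (map edgeC l) (inr (v b)).
Proof.
by elim: l a => [|c l IH] a /= => [->|[ca /IH wk]] //; split=> //; rewrite ca.
Qed.

Lemma walk_assemble x y p f l q b : walk x p (v (cross_src f)) ->
  chain (cross_tgt f) l b -> walk y q (v b) ->
  walk (inl x : vert Glink) (assemble p f l q) (inr y).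
Proof.
move=> wp cl wq; apply/walk_cat; exists (inl (v (cross_src f))).
  exact: walk_edgeL.
split; first exact: src_edgeX.
rewrite tgt_edgeX; apply/walk_cat; exists (inr (v b)); first exact: walk_edgeC.
exact: walk_edgeR.
Qed.

Hypothesis v_inj : injective v.
Hypothesis v_sink : forall i, sink (v i).

(** As the [v i] are sinks of [G], no reversed edge enters a [v'_i]; a walk in the mirror image that
    is off these vertices can never use an added edge. *)
Lemma walk_right z s y : (forall i, z <> v i) ->
  walk (inr z : vert Glink) s (inr y) ->
  exists2 q : seq (edge G), s = map edgeR (rev q) & walk y q z.
Proof.
elim: s z => [|[[e|e]|[[i|c]|c]] s IH] z zv /= => [[->]|[]|[[ez]]|[]|[]|[[cz]]] //.
- by exists [::].
- move=> /(IH (@src K G e) (fun i => @v_sink i e))[q -> wq].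
  exists (rcons q e); first by rewrite rev_rcons.
  by rewrite -cats1; apply/walk_cat; exists (@src K G e).
- by case: (zv (h1 c)).
Qed.

Lemma walk_middle a s y : walk (inr (v a) : vert Glink) s (inr y) ->
  exists l q b, [/\ s = map edgeC l ++ map edgeR (rev q), chain a l b &
                    walk y q (v b)].
Proof.
elim: s a => [|[[e|e]|[[i|c]|c]] s IH] a /= => [[va]|[]|[[ea]]|[]|[]|[[ca]]] //.
- by exists [::], [::], a; split=> //=.
- move=> /(walk_right (fun i => @v_sink i e))[q -> wq].
  exists [::], (rcons q e), a; split=> //=; first by rewrite rev_rcons.
  by rewrite -cats1; apply/walk_cat; exists (@src K G e).
- move=> /IH[l [q [b [-> cl wq]]]]; exists (c :: l), q, b; split=> //=.
  by split=> //; exact: v_inj.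
Qed.

(** Only a crossing leads out of [G] and no edge leads back, so the walk splits at its single
    crossing. *)
Lemma walk_left x s y : walk (inl x : vert Glink) s (inr y) ->
  exists p f l q b, [/\ s = assemble p f l q, walk x p (v (cross_src f)),
    chain (cross_tgt f) l b & walk y q (v b)].
Proof.
elim: s x => [|[[e|e]|[f|c]] s IH] x // [].
- move=> [ex] /IH[p [f [l [q [b [-> wp cl wq]]]]]].
  by exists (e :: p), f, l, q, b; split.
- by [].
- rewrite -[inr (inl f)]/(edgeX f) src_edgeX tgt_edgeX => -[fx].
  move=> /walk_middle[l [q [b [-> cl wq]]]].
  by exists [::], f, l, q, b; split.
- by [].
Qed.

Lemma walk_right_left z s y : ~ walk (inr z : vert Glink) s (inl y).
Proof.
by elim: s z => [|[[e|e]|[[i|c]|c]] s IH] z //= [] // _ /IH.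
Qed.

Lemma walk_left_left x s y : walk (inl x : vert Glink) s (inl y) ->
  exists2 p, s = map edgeL p & walk x p y.
Proof.
elim: s x => [|[[e|e]|[f|c]] s IH] x //= [].
- by move=> ->; exists [::].
- by move=> [ex] /IH[p -> wp]; exists (e :: p).
- by [].
- by move=> _; case: f => ? /walk_right_left.
- by [].
Qed.

(* [rho] is the position along the chain of the [v'_i]: increasing in the index
   for [Gbar], decreasing for [Gtilde]. *)
Variable rho : 'I_n -> nat.
Hypothesis rho_inj : injective rho.
Hypothesis rho_h : forall c, rho (h2 c) = (rho (h1 c)).+1.
Hypothesis h1_inj : injective h1.
Hypothesis h1_ex : forall a b : 'I_n, (rho a < rho b)%N -> exists c, h1 c = a.

Lemma chain_le a l b : chain a l b -> (rho a <= rho b)%N.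
Proof.
elim: l a => [|c l IH] a /= => [->|[<- /IH]] //.
by rewrite rho_h; exact: ltnW.
Qed.

(** Each step raises [rho] by one and, as [h1] is injective, is determined by its start. *)
Lemma chain_uniq a l l' b : chain a l b -> chain a l' b -> l = l'.
Proof.
elim: l l' a => [|c l IH] [|c' l'] a //=.
- by move=> -> [<- /chain_le]; rewrite rho_h ltnn.
- by move=> [<- /chain_le le_cb] eqb; move: le_cb; rewrite -eqb rho_h ltnn.
- by move=> [<- cl] [/h1_inj -> cl']; rewrite (IH _ _ cl cl').
Qed.

Lemma chain_ex a b : (rho a <= rho b)%N -> exists l, chain a l b.
Proof.
move: {2}(rho b - rho a)%N (erefl (rho b - rho a)%N) => d.
elim: d a => [|d IH] a eqd leab.
  by exists [::]; apply: rho_inj; lia.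
have [|c ca] := @h1_ex a b; first by lia.
by have [||l cl] := IH (h2 c); rewrite ?rho_h ?ca; [lia|lia|exists (c :: l)].
Qed.

Lemma chain_mem a l b d : chain a l b -> (rho a <= rho d <= rho b)%N ->
  d \in a :: map h2 l.
Proof.
elim: l a => [|c l IH] a /= => [->|[<- cl]] dP.
  by rewrite inE; apply/eqP/rho_inj; lia.
rewrite inE; case: eqVneq => //= dc; apply: IH cl _; rewrite rho_h.
have : rho d != rho (h1 c) by apply: contra_neq dc; exact: rho_inj.
lia.
Qed.

(** A closed walk stays on one side of the crossings. It comes from a closed walk of [G], or it is a
    closed chain, on which [rho] cannot rise. *)
Lemma Glink_acyclic : acyclic G -> acyclic Glink.
Proof.
move=> Gac [x|x] s.
  by move=> /walk_left_left[p -> /Gac ->].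
case: (pselect (exists a, x = v a)) => [[a ->]|xv].
  move=> /walk_middle[l [q [b [-> cl wq]]]].
  have q0 : q = [::] by case: q wq => // e q [/v_sink].
  move: wq cl; rewrite q0 => /= /v_inj <-.
  by move=> cl; rewrite (chain_uniq cl (erefl : chain a [::] a)).
move=> /walk_right[i|q -> /Gac -> //].
by move=> xi; apply: xv; exists i.
Qed.

Lemma path_wt_assemble (x : vert Glink) y z p f l q :
  path_wt ((x, assemble p f l q) : gpath Glink) =
  path_wt ((y, p) : gpath G) * path_wt ((z, q) : gpath G).
Proof.
rewrite /path_wt /= /assemble big_cat big_cons big_cat !big_map /= mul1r.
rewrite [X in _ * (X * _)]big1 // mul1r; congr (_ * _).
by rewrite [RHS](perm_big (rev q)) // perm_sym perm_rev.
Qed.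

(** By [walk_left] a path consists of [p], [f], [l] and [q], where [l] is determined by its ends and
    exists exactly when [rho] does not decrease between them. Added edges have weight 1, so the
    weights of [p] and [q] multiply. *)
Lemma Glink_path_gf x y :
  (forall a, GF_defined (paths x (v a))) -> (forall a, GF_defined (paths y (v a))) ->
  GF_defined (paths (inl x : vert Glink) (inr y)) /\
  path_gf (inl x : vert Glink) (inr y) =
  \sum_(fb : crossing * 'I_n | (rho (cross_tgt fb.1) <= rho fb.2)%N)
     path_gf x (v (cross_src fb.1)) * path_gf y (v fb.2).
Proof.
move=> finx finy.
pose r z a : seq (gpath G) := finite_support 0 (paths z (v a)) path_wt.
have rP z : (forall a, GF_defined (paths z (v a))) ->
    forall a (p : gpath G), p \in r z a = `[< paths z (v a) p >] && (path_wt p != 0).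
  move=> fin a p; rewrite /r in_finite_support; last first.
    by apply: sub_finite_set (fin a) => q [? /eqP].
  apply/idP/andP; rewrite inE.
    by move=> [/= ? /eqP ?]; split=> //; apply/asboolP.
  by move=> [? /eqP ?]; rewrite inE; split.
have gfE z a : path_gf z (v a) = \sum_(p <- r z a) path_wt p by [].
have /choice[ch chP] (ab : 'I_n * 'I_n) :
    exists l, (rho ab.1 <= rho ab.2)%N -> chain ab.1 l ab.2.
  have [/chain_ex[l cl]|_] := leqP (rho ab.1) (rho ab.2); first by exists l.
  by exists [::].
pose I := [seq fb <- index_enum (crossing * 'I_n)%type |
             (rho (cross_tgt fb.1) <= rho fb.2)%N].
pose t (fb : crossing * 'I_n) :=
  [seq (P, Q) | P <- r x (cross_src fb.1), Q <- r y fb.2].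
pose asm (fb : crossing * 'I_n) (pq : gpath G * gpath G) : gpath Glink :=
  (inl x, assemble pq.1.2 fb.1 (ch (cross_tgt fb.1, fb.2)) pq.2.2).
pose E := [seq asm fb pq | fb <- I, pq <- t fb].
have tP fb pq : pq \in t fb ->
    [/\ paths x (v (cross_src fb.1)) pq.1, paths y (v fb.2) pq.2,
        path_wt pq.1 != 0 & path_wt pq.2 != 0].
  case/allpairsP => -[p q] /= []; rewrite !rP // => /andP[/asboolP ? ?].
  by move=> /andP[/asboolP ? ?] ->.
have Eu : uniq E.
  apply: allpairs_uniq_dep.
  - by rewrite filter_uniq // index_enum_uniq.
  - by move=> fb _; apply: allpairs_uniq; rewrite ?finite_support_uniq // => -[? ?] [? ?].
  (* The three kinds of edges recover [p], [q] and [f] from an assembled path; then [b] is recovered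
     from the end of [q], by injectivity of [v]. *)
  pose getL (e : edge Glink) := if e is inl (inl e') then Some e' else None.
  pose getR (e : edge Glink) := if e is inl (inr e') then Some e' else None.
  pose getX (e : edge Glink) := if e is inr (inl f) then Some f else None.
  have getLE p f l q : pmap getL (assemble p f l q) = p.
    rewrite pmap_cat /= pmap_cat; elim: p => [|e p /= -> //] /=.
    by elim: l => //=; elim: (rev q).
  have getRE p f l q : pmap getR (assemble p f l q) = rev q.
    rewrite pmap_cat /= pmap_cat; elim: p => //=; elim: l => //=.
    by elim: (rev q) => //= e s ->.
  have getXE p f l q : pmap getX (assemble p f l q) = [:: f].
    rewrite pmap_cat /= pmap_cat; elim: p => //=; elim: l => //=.
    by elim: (rev q).
  move=> fbpq fbpq' /allpairsPdep[[f b] [[[p1 p] [q1 q]] [_ /tP[]]]].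
  move=> /= [/= -> wp] [/= -> wq] _ _ ->.
  move=> /allpairsPdep[[f' b'] [[[p1' p'] [q1' q']] [_ /tP[]]]].
  move=> /= [/= -> wp'] [/= -> wq'] _ _ -> /= [] eqs.
  have := congr1 (pmap getL) eqs; rewrite !getLE => eqp.
  have := congr1 (pmap getR) eqs; rewrite !getRE => /(can_inj revK) eqq.
  have := congr1 (pmap getX) eqs; rewrite !getXE => -[eqf]; subst.
  have := walk_last wq; rewrite (walk_last wq') => /v_inj eqb; subst.
  by [].
have E_sub P : P \in E -> paths (inl x : vert Glink) (inr y) P.
  case/allpairsPdep => fb [pq [fbI /tP[[_ wp] [_ wq] _ _] ->]]; split=> //=.
  apply: walk_assemble wq => //; move: fbI; rewrite mem_filter => /andP[le_fb _].
  exact: chP (cross_tgt fb.1, fb.2) _.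
have E_sup P : paths (inl x : vert Glink) (inr y) P -> path_wt P != 0 -> P \in E.
  case: P => P1 s [/= -> /walk_left[p [f [l [q [b [-> wp cl wq]]]]]]].
  rewrite (path_wt_assemble _ x y) => pq0.
  have le_fb := chain_le cl.
  apply/allpairsPdep; exists (f, b), ((x, p), (y, q)); split.
  - by rewrite mem_filter le_fb mem_index_enum.
  - apply/allpairsP; exists ((x, p), (y, q)); split=> //=; rewrite rP //.
      apply/andP; split; first by apply/asboolP; split.
      by apply: contra_neq pq0 => ->; rewrite mul0r.
    apply/andP; split; first by apply/asboolP; split.
    by apply: contra_neq pq0 => ->; rewrite mulr0.
  by rewrite /asm /= (chain_uniq cl (chP (cross_tgt f, b) le_fb)).
split.
  apply: (@sub_finite_set _ _ [set` E]); last exact: finite_seq.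
  by move=> P [aP wP]; exact: E_sup.
rewrite /path_gf (fsum_seqE Eu E_sub E_sup) big_allpairs_dep big_filter.
apply: eq_bigr => fb _; rewrite -!/(path_gf _ _) !gfE big_allpairs_dep.
rewrite big_distrl; apply: eq_bigr => p _; rewrite big_distrr.
by apply: eq_bigr => q _; rewrite (path_wt_assemble _ p.1 q.1) -!surjective_pairing.
Qed.

(** The straight edge at [a] contributes the first summand, and the diagonal edge, which raises
    [rho] by one, the second. *)
Lemma cross_count a b :
  \sum_(f | cross_src f == a) (rho (cross_tgt f) <= rho b)%N%:R =
  (rho a <= rho b)%N%:R + (rho a < rho b)%N%:R :> K.
Proof.
rewrite big_sumType /= big_pred1_eq; congr (_ + _).
have [lt_ab|le_ba] := ltnP (rho a) (rho b).
  have [c ca] := h1_ex lt_ab; rewrite (big_pred1 c) ?rho_h ?ca ?lt_ab // => c'.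
  by rewrite -ca (inj_eq h1_inj).
by apply: big1 => c /eqP ca; rewrite rho_h ca ltnNge le_ba.
Qed.

Lemma Glink_path_mx m (u : 'I_m -> vert G) :
  (forall i a, GF_defined (paths (u i) (v a))) ->
  let A := \matrix_(i, a) path_gf (u i) (v a) in
  \matrix_(i, j) path_gf (inl (u i) : vert Glink) (inr (u j)) =
  A *m (\matrix_(a, b) ((rho a <= rho b)%N%:R + (rho a < rho b)%N%:R)) *m A^T.
Proof.
move=> fin A; apply/matrixP => i j; rewrite mxE.
have [_ ->] := Glink_path_gf (fin i) (fin j).
transitivity (\sum_(f : crossing) \sum_b (rho (cross_tgt f) <= rho b)%N%:R *
   (A i (cross_src f) * A j b)).
  rewrite pair_big /= big_mkcond; apply: eq_bigr => -[f b] _ /=.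
  by rewrite !mxE; case: leqP; rewrite ?mul1r ?mul0r.
rewrite exchange_big [RHS]mxE; apply: eq_bigr => b _.
(* Crossings are grouped by their source, so that [cross_count] supplies the entries of the middle
   matrix. *)
rewrite [X in X * _]mxE big_distrl (partition_big cross_src xpredT) //=.
apply: eq_bigr => a _.
rewrite (eq_bigr (fun f => (rho (cross_tgt f) <= rho b)%N%:R * (A i a * A j b)));
  last by move=> f /eqP ->.
rewrite -big_distrl /= cross_count [X in _ = _ * X * _]mxE [A^T b j]mxE.
by rewrite mulrA [_ * A i a]mulrC.
Qed.

Lemma mem_assemble x y p f l q b : walk x p (v (cross_src f)) ->
  chain (cross_tgt f) l b -> walk y q (v b) ->
  let V := path_verts ((inl x, assemble p f l q) : gpath Glink) in
  [/\ forall z, z \in path_verts ((x, p) : gpath G) -> inl z \in V,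
      forall d, d \in cross_tgt f :: map h2 l -> inr (v d) \in V &
      forall z, z \in path_verts ((y, q) : gpath G) -> inr z \in V].
Proof.
move=> wp cl wq V.
have VE : V = map inl (x :: [seq tgt e | e <- p]) ++
     map (inr \o v) (cross_tgt f :: map h2 l) ++ map inr [seq src e | e <- rev q].
  rewrite /V /path_verts /= /assemble map_cat /= map_cat -!map_comp.
  by congr (_ :: _ ++ _ :: _ ++ _); case: (f).
have V2 d : d \in cross_tgt f :: map h2 l -> inr (v d) \in V.
  by move=> dl; rewrite VE !mem_cat (map_f (inr \o v) dl) orbT.
split=> // z.
  by move=> zp; rewrite VE mem_cat map_f.
(* The end [v b] of [q] is found as the last vertex of the chain; the other vertices of [q] are
   sources of its edges. *)
rewrite /path_verts /= (walk_src wq) mem_rcons inE => /predU1P[->|zq].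
  by apply: V2; apply: (chain_mem cl); rewrite leqnn (chain_le cl).
by rewrite VE !mem_cat map_rev map_rev mem_rev (map_f inr zq) !orbT.
Qed.

Hypothesis rho_mono : (forall a b : 'I_n, (a < b) = (rho a < rho b))%N \/
                      (forall a b : 'I_n, (a < b) = (rho b < rho a))%N.

(** Compatibility orders the indices [a k] at which [G] is left like [s k], and the indices [b k] at
    which the chain is left like [k]. Disjointness along the chain orders both families alike, so
    [s] is the identity. *)
Lemma Glink_compatible m (u : 'I_m -> vert G) (s : 'S_m) P :
  compatible u v ->
  P0fix (fun k => inl (u k) : vert Glink) (fun k => inr (u k)) s P -> s = 1%g.
Proof.
move=> uv [nP sP].
have /choice[d dP] (k : 'I_m) : exists d : seq (edge G) * crossing *
    seq (consec n) * seq (edge G) * 'I_n,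
    [/\ P k = (inl (u (s k)), assemble d.1.1.1.1 d.1.1.1.2 d.1.1.2 d.1.2),
        walk (u (s k)) d.1.1.1.1 (v (cross_src d.1.1.1.2)),
        chain (cross_tgt d.1.1.1.2) d.1.1.2 d.2 & walk (u k) d.1.2 (v d.2)].
  have := sP k; case: (P k) => x t [/= -> /walk_left[p [f [l [q [b]]]]]].
  by move=> [-> wp cl wq]; exists (p, f, l, q, b).
pose a k := cross_src (d k).1.1.1.2; pose b k := (d k).2.
have memP k := let: And4 e wp cl wq := dP k in mem_assemble wp cl wq.
have last_mem x p y : walk x p y -> y \in path_verts ((x, p) : gpath G).
  by move=> /walk_last <-; exact: mem_last.
have disjL k l : k != l -> ~ intersect (u (s k), (d k).1.1.1.1)
    ((u (s l), (d l).1.1.1.1) : gpath G).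
  move=> kl [z zk zl]; apply: (nP _ _ kl); exists (inl z).
    by have [-> _ _ _] := dP k; have [+ _ _] := memP k; apply.
  by have [-> _ _ _] := dP l; have [+ _ _] := memP l; apply.
have disjM k l e : k != l -> e \in cross_tgt (d k).1.1.1.2 :: map h2 (d k).1.1.2 ->
    e \in cross_tgt (d l).1.1.1.2 :: map h2 (d l).1.1.2 -> False.
  move=> kl ek el; apply: (nP _ _ kl); exists (inr (v e)).
    by have [-> _ _ _] := dP k; have [_ + _] := memP k; apply.
  by have [-> _ _ _] := dP l; have [_ + _] := memP l; apply.
have disjR k l : k != l -> ~ intersect (u k, (d k).1.2)
    ((u l, (d l).1.2) : gpath G).
  move=> kl [z zk zl]; apply: (nP _ _ kl); exists (inr z).
    by have [-> _ _ _] := dP k; have [_ _ +] := memP k; apply.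
  by have [-> _ _ _] := dP l; have [_ _ +] := memP l; apply.
have lt_a k l : (s k < s l)%N -> (a k < a l)%N.
  move=> skl; have kl : k != l by apply: contraTneq skl => ->; rewrite ltnn.
  have [_ wk _ _] := dP k; have [_ wl _ _] := dP l.
  have [//|lt_lk|/val_inj eq_kl] := ltngtP (a k) (a l).
    by case: (disjL _ _ kl); apply: (uv _ _ _ _ skl lt_lk).
  case: (disjL _ _ kl); exists (v (a k)); first exact: last_mem wk.
  by rewrite eq_kl; exact: last_mem wl.
have lt_b (k l : 'I_m) : (k < l)%N -> (b k < b l)%N.
  move=> lt_kl; have kl : k != l by apply: contraTneq lt_kl => ->; rewrite ltnn.
  have [_ _ _ wk] := dP k; have [_ _ _ wl] := dP l.
  have [//|lt_lk|/val_inj eq_kl] := ltngtP (b k) (b l).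
    by case: (disjR _ _ kl); apply: (uv _ _ _ _ lt_kl lt_lk).
  case: (disjR _ _ kl); exists (v (b k)); first exact: last_mem wk.
  by rewrite eq_kl; exact: last_mem wl.
(* A crossing raises [rho] by at most one, so the chain of path [k] starts no later than [a l]. If
   it also ended no earlier than [b l], it would contain [b l] and meet path [l]. *)
have rho_ab k l : (rho (a k) < rho (a l))%N -> (rho (b k) < rho (b l))%N.
  move=> lt_kl; have kl : k != l by apply: contraTneq lt_kl => ->; rewrite ltnn.
  have [_ _ ck _] := dP k; have [_ _ cl _] := dP l.
  rewrite ltnNge; apply/negP => le_lk.
  have le_t (f : crossing) : (rho (cross_src f) <= rho (cross_tgt f)
      <= (rho (cross_src f)).+1)%N.
    by case: f => [i|c] /=; rewrite ?rho_h leqnn leqnSn.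
  have /andP[_ tk] := le_t (d k).1.1.1.2; have /andP[tl _] := le_t (d l).1.1.1.2.
  have lel := chain_le cl.
  apply: (disjM k l (b l) kl); first apply: (chain_mem ck).
    rewrite le_lk andbT (leq_trans tk) // (leq_trans lt_kl) //.
    exact: leq_trans tl lel.
  by apply: (chain_mem cl); rewrite leqnn lel.
apply: perm_ltn_id => k l skl; have lt_akl := lt_a _ _ skl.
have lt_bkl : (b k < b l)%N.
  (* For a decreasing [rho], [rho_ab] is used with [k] and [l] exchanged. *)
  case: rho_mono => rhoE; move: lt_akl; rewrite !rhoE; exact: rho_ab.
have [//|/lt_b|/val_inj eq_kl] := ltngtP k l.
  by rewrite ltnNge ltnW.
by move: skl; rewrite eq_kl ltnn.
Qed.

End LinkedGraph.

(** * The signed sum over [P0] as a sum of maximal minors *)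

Section Squares.
Context {K : comPzRingType} {G : wdigraph K} {m n : nat}.
Variables (u : 'I_m -> vert G) (v : 'I_n -> vert G).
Hypothesis v_inj : injective v.
Hypothesis G_acyclic : acyclic G.
Hypothesis GF_def : forall i j, GF_defined (paths (u i) (v j)).

(** Sorting the tuples by their increasing end indices reduces the sum to Lindstrom's lemma with
    ends [v \o j], whose matrix is a column selection. *)
Lemma P0_minor_sum :
  \sum_(s : 'S_m) (-1) ^+ s * GF (P0 u v s) =
  minor_sum (\matrix_(i, a) path_gf (u i) (v a)).
Proof.
have GF_P0 s : GF (P0 u v s) =
    \sum_(j : {ffun 'I_m -> 'I_n} | increasing j) GF (P0fix u (v \o j) s).
  have /finite_seqP[r rP] : finite_set (\bigcup_(j in [set: {ffun 'I_m -> 'I_n}])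
      (tuples u (v \o j) s `&` [set P | tuple_wt P != 0])).
    apply: bigcup_finite; first exact: finite_finset.
    by move=> j _; apply: tuples_finite => i k; exact: GF_def.
  pose r' := undup r.
  have in_r (j : {ffun 'I_m -> 'I_n}) P : tuples u (v \o j) s P ->
      tuple_wt P != 0 -> P \in r'.
    move=> sP wP; rewrite mem_undup; have : [set` r] P by rewrite -rP; exists j.
    by [].
  have fixE (j : {ffun 'I_m -> 'I_n}) : GF (P0fix u (v \o j) s) =
      \sum_(P <- r' | `[< P0fix u (v \o j) s P >]) tuple_wt P.
    rewrite -big_filter; apply: fsum_seqE.
    - by rewrite filter_uniq // undup_uniq.
    - by move=> P; rewrite mem_filter => /andP[/asboolP].
    - move=> P aP wP; rewrite mem_filter; apply/andP; split; first exact/asboolP.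
      by case: aP => _ sP; exact: in_r sP wP.
  under [RHS]eq_bigr do rewrite fixE.
  rewrite (exchange_big_dep (fun P => `[< P0 u v s P >])) /=; last first.
    move=> j P jJ /asboolP[nP sP]; apply/asboolP; split=> //; exists j; split=> //.
    exact/increasingP.
  rewrite /GF (fsum_seqE (r := [seq P <- r' | `[< P0 u v s P >]])).
  - rewrite big_filter; apply: eq_bigr => P /asboolP[nP [j [jJ sP]]].
    (* Injectivity of [v] makes the end indices a function of the tuple, so the tuple is counted for
       exactly one [j]. *)
    rewrite (big_pred1 [ffun k => j k]) // => j'.
    apply/andP/eqP => [[_ /asboolP[_ sP']]|->].
      apply/ffunP => k; rewrite ffunE; apply: v_inj.
      by have [_ /walk_last <-] := sP k; have [_ /walk_last] := sP' k.
    split; first by apply/increasingP => k l kl; rewrite !ffunE; exact: jJ.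
    by apply/asboolP; split=> // k; rewrite /= ffunE; exact: sP.
  - by rewrite filter_uniq // undup_uniq.
  - by move=> P; rewrite mem_filter => /andP[/asboolP].
  - move=> P aP wP; rewrite mem_filter; apply/andP; split; first exact/asboolP.
    case: aP => _ [j [_ sP]]; apply: (in_r [ffun k => j k]) wP => k.
    by rewrite /= ffunE; exact: sP.
under eq_bigr do rewrite GF_P0 big_distrr /=.
rewrite exchange_big /=; apply: eq_bigr => j _.
rewrite lindstrom //; last by move=> i k; exact: GF_def.
by congr (\det _); apply/matrixP => i k; rewrite !mxE.
Qed.

Lemma P0_compatible (s : 'S_m) P : compatible u v -> P0 u v s P -> s = 1%g.
Proof.
move=> uv [nP [j [jJ sP]]].
apply: perm_ltn_id => k l skl.
have kl : k != l by apply: contraTneq skl => ->; rewrite ltnn.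
rewrite ltn_neqAle kl /= leqNgt; apply/negP => /jJ lt_lk.
exact: nP kl (uv _ _ _ _ skl lt_lk _ _ (sP k) (sP l)).
Qed.

End Squares.

Lemma signed_GF_only1 (K : comPzRingType) (H : wdigraph K) m
    (A : 'S_m -> set {ffun 'I_m -> gpath H}) :
  (forall s P, A s P -> s = 1%g) ->
  \sum_(s : 'S_m) (-1) ^+ s * GF (A s) = GF (A 1%g).
Proof.
move=> A1; rewrite (bigD1 1%g) //= odd_perm1 mul1r big1 ?addr0 // => s s1.
rewrite (_ : A s = set0) ?/GF ?fsbig_set0 ?mulr0 //.
by apply/seteqP; split=> // P /A1 s_eq1; rewrite s_eq1 eqxx in s1.
Qed.

(** The points [phi (t i, 0)] are distinct, because [t] is strictly increasing and [phi] is
    injective on the square. *)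
Lemma face_injective (R : realType) (K : comPzRingType) (G : wdigraph K)
    (D : drawing R G) n (v : 'I_n -> vert G) :
  on_unbounded_face_in_cyclic_order D v -> injective v.
Proof.
move=> [F [phi [t [_ [_ phi_inj] [t01 t_mono] phi_v _]]]] i j vij.
have : (t i, 0 : R) = (t j, 0).
  apply: phi_inj; rewrite ?phi_v ?vij //; apply/mem_set; split=> //=;
    by rewrite in_itv /= lexx ler01.
move=> [tij]; have [/t_mono|/t_mono|/val_inj //] := ltngtP i j.
  by rewrite tij ltxx.
by rewrite tij ltxx.
Qed.

(** * Consecutive indices in increasing and decreasing order *)

Section Links.
Context {n : nat}.
Definition consec_fst (c : consec n) : 'I_n := (val c).1.
Definition consec_snd (c : consec n) : 'I_n := (val c).2.

Lemma consec_sndE c : consec_snd c = (consec_fst c).+1 :> nat.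
Proof. by apply/eqP; exact: (valP c). Qed.

Lemma consec_fst_inj : injective consec_fst.
Proof.
move=> c d e; apply/val_inj; move: (consec_sndE c) (consec_sndE d) e.
rewrite /consec_fst /consec_snd; case: (val c) (val d) => [a b] [a' b'] /=.
by move=> + + e; rewrite e => <- /val_inj ->.
Qed.

Lemma consec_snd_inj : injective consec_snd.
Proof.
move=> c d e; apply: consec_fst_inj; apply/val_inj/eq_add_S.
by rewrite -!consec_sndE e.
Qed.

Lemma consec_ex (a b : 'I_n) : b = a.+1 :> nat ->
  exists2 c, consec_fst c = a & consec_snd c = b.
Proof.
move=> /eqP ab.
by exists (exist (fun ij : 'I_n * 'I_n => ij.2 == ij.1.+1 :> nat) (a, b) ab).
Qed.

(** The position for [Gtilde], whose chain runs towards smaller indices; as [i < n], the subtraction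
    is never truncated. *)
Definition down (i : 'I_n) : nat := (n - i)%N.

Lemma down_inj : injective down.
Proof.
move=> i j; rewrite /down => e; apply/val_inj => /=.
by have := ltn_ord i; have := ltn_ord j; lia.
Qed.

Lemma down_consec c : down (consec_fst c) = (down (consec_snd c)).+1.
Proof.
by have := ltn_ord (consec_snd c); rewrite /down consec_sndE; lia.
Qed.

Lemma down_ltn (a b : 'I_n) : (a < b)%N = (down b < down a)%N.
Proof. by have := ltn_ord a; have := ltn_ord b; rewrite /down; lia. Qed.

Lemma consec_fst_ex (a b : 'I_n) : (a < b)%N -> exists c, consec_fst c = a.
Proof.
move=> ab; have lt_n : (a.+1 < n)%N by exact: leq_ltn_trans ab (ltn_ord b).
by have [c] := @consec_ex a (Ordinal lt_n) erefl; exists c.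
Qed.

Lemma consec_snd_ex (a b : 'I_n) : (down a < down b)%N ->
  exists c, consec_snd c = a.
Proof.
rewrite -down_ltn => ba.
have lt_n : (a.-1 < n)%N by have := ltn_ord a; lia.
have [|c] := @consec_ex (Ordinal lt_n) a; first by rewrite /=; lia.
by exists c.
Qed.

End Links.

(** * The sums for both symmetric graphs as one determinant *)

Section Main.
Context {K : comPzRingType} {G : wdigraph K} {m n : nat}.
Variables (u : 'I_m -> vert G) (v : 'I_n -> vert G).
Hypothesis v_inj : injective v.
Hypothesis v_sink : forall i, sink (v i).
Hypothesis G_acyclic : acyclic G.
Hypothesis GF_def : forall i j, GF_defined (paths (u i) (v j)).

Let A := \matrix_(i, a) path_gf (u i) (v a).

Lemma P0bar_det : \sum_(s : 'S_m) (-1) ^+ s * GF (P0bar v u s) =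
  \det (link_gram A).
Proof.
have path_gfP i j := Glink_path_gf v_inj v_sink (@ord_inj n) consec_sndE
  consec_fst_inj consec_fst_ex (GF_def i) (GF_def j).
rewrite [LHS](@lindstrom K (Glink v consec_fst consec_snd)).
- by rewrite (Glink_path_mx v_inj v_sink (@ord_inj n) consec_sndE
    consec_fst_inj consec_fst_ex GF_def).
- exact (Glink_acyclic v_inj v_sink (rho := @nat_of_ord n) consec_sndE
    consec_fst_inj G_acyclic).
- by move=> i j; have [] := path_gfP i j.
Qed.

Lemma P0tilde_det : \sum_(s : 'S_m) (-1) ^+ s * GF (P0tilde v u s) =
  \det (link_gram A).
Proof.
have path_gfP i j := Glink_path_gf v_inj v_sink down_inj down_consec
  consec_snd_inj consec_snd_ex (GF_def i) (GF_def j).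
rewrite [LHS](@lindstrom K (Glink v consec_snd consec_fst)).
(* Reversing the positions transposes the link matrix, so the path matrix is the transpose of
   [link_gram A]. *)
- rewrite (Glink_path_mx v_inj v_sink down_inj down_consec
    consec_snd_inj consec_snd_ex GF_def) -[RHS]det_tr.
  rewrite /link_gram !trmx_mul trmxK mulmxA.
  congr (\det (_ *m _ *m _)); apply/matrixP => a b.
  by rewrite !mxE -down_ltn leqNgt -down_ltn -leqNgt.
- exact (Glink_acyclic v_inj v_sink (rho := @down n) down_consec consec_snd_inj
    G_acyclic).
- by move=> i j; have [] := path_gfP i j.
Qed.

End Main.

Theorem theorem2p5 (R : realType) (K : comPzRingType) (G : wdigraph K)
    (D : drawing R G) (m n : nat)
    (u : 'I_m -> vert G) (v : 'I_n -> vert G)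
    (le_mn : (m <= n)%N)
    (G_locally_finite : locally_finite G)
    (G_acyclic : acyclic G)
    (D_embedding : plane_embedding D)
    (v_sink : forall i, sink (v i))
    (v_face : on_unbounded_face_in_cyclic_order D v)
    (GF_def : forall i j, GF_defined (paths (u i) (v j))) :
  ((\sum_(s : 'S_m) (-1) ^+ s * GF (P0 u v s)) ^+ 2
     = \sum_(s : 'S_m) (-1) ^+ s * GF (P0bar v u s)
   /\ \sum_(s : 'S_m) (-1) ^+ s * GF (P0bar v u s)
     = \sum_(s : 'S_m) (-1) ^+ s * GF (P0tilde v u s))
  /\ (compatible u v ->
      GF (P0 u v 1%g) ^+ 2 = GF (P0bar v u 1%g)
      /\ GF (P0bar v u 1%g) = GF (P0tilde v u 1%g)).
Proof.
have v_inj := face_injective v_face.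
have eqs : (\sum_(s : 'S_m) (-1) ^+ s * GF (P0 u v s)) ^+ 2
     = \sum_(s : 'S_m) (-1) ^+ s * GF (P0bar v u s)
   /\ \sum_(s : 'S_m) (-1) ^+ s * GF (P0bar v u s)
     = \sum_(s : 'S_m) (-1) ^+ s * GF (P0tilde v u s).
  by rewrite P0_minor_sum // minor_sum_sqr // P0bar_det // P0tilde_det.
split=> // uv; move: eqs; rewrite !signed_GF_only1 //.
- move=> s P; exact: (Glink_compatible v_inj v_sink (@down_inj n) down_consec
    (or_intror (@down_ltn n))).
- move=> s P; exact: (Glink_compatible v_inj v_sink (@ord_inj n) consec_sndE
    (or_introl (fun a b : 'I_n => erefl))).
- by move=> s P; exact: P0_compatible.
Qed.
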